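(* Let $p\ge 2$, $\theta,\alpha\ge 0$ and $\mu>0$ be real numbers such that $\alpha-(p-1)=0$ and $\mu\le\mu_{\alpha,\theta}$. Then there exists a constant $D(\theta,\alpha,\mu)$, depending only on $\theta$, $\alpha$ and $\mu$, such that $$\int_0^\infty A_{p,\mu}(|u(x)|)\,d\lambda_\theta(x)\le D(\theta,\alpha,\mu)$$ for all $u\in W^{1,p}_{\alpha,\theta}(0,\infty)$ with $\|u\|_{W^{1,p}_{\alpha,\theta}(0,\infty)}=1$. Furthermore, the inequality fails if $\mu>\mu_{\alpha,\theta}$; that is, (for $p\ge2$, $\theta\ge 0$, $\alpha=p-1$) for any $\mu>\mu_{\alpha,\theta}$ there exists a sequence $(u_j)\subset W^{1,p}_{\alpha,\theta}(0,\infty)$ (of nonzero functions) such that $$\int_0^\infty A_{p,\mu}\left(\frac{|u_j(x)|}{\|u_j\|_{W^{1,p}_{\alpha,\theta}(0,\infty)}}\right)d\lambda_\theta(x)\to\infty\quad\text{as } j\to\infty.$$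
   Context: For $\beta\ge 0$ put $\omega_\beta=\frac{2\pi^{(1+\beta)/2}}{\Gamma((1+\beta)/2)}$ and $d\lambda_\beta(x)=\omega_\beta x^\beta dx$ on $(0,\infty)$. For $1\le p<\infty$ and $0<R\le\infty$, $L^p_\beta(0,R)$ is the space of measurable $u$ on $(0,R)$ with $\|u\|_{L^p_\beta(0,R)}=\left(\int_0^R|u|^p\,d\lambda_\beta\right)^{1/p}<\infty$. For $\alpha,\theta\ge0$, $W^{1,p}_{\alpha,\theta}(0,R)=\{u\in L^p_\theta(0,R):\ u'\in L^p_\alpha(0,R),\ \lim_{x\to R^-}u(x)=0\}$ (with $u$ locally absolutely continuous, $u'$ its derivative), with norm $\|u\|_{W^{1,p}_{\alpha,\theta}(0,R)}=\left(\|u'\|^p_{L^p_\alpha(0,R)}+\|u\|^p_{L^p_\theta(0,R)}\right)^{1/p}$. $\lfloor p\rfloor$ denotes the largest integer strictly less than $p$ (so $\lfloor p\rfloor=p-1$ if $p$ is an integer). For $t\ge0$, $A_{p,\mu}(t)=e^{\mu t^{p/(p-1)}}-\sum_{j=0}^{\lfloor p\rfloor-1}\frac{\mu^j}{j!}t^{\frac{p}{p-1}j}$. $\mu_{\alpha,\theta}:=(1+\theta)\,\omega_\alpha^{1/\alpha}$. *)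

(* Defs.v *)
From mathcomp Require Import all_boot all_order all_algebra.
From mathcomp Require Import all_classical all_reals all_analysis.
Set Implicit Arguments.
Unset Strict Implicit.
Unset Printing Implicit Defensive.
Import Order.TTheory GRing.Theory Num.Theory.
Import numFieldNormedType.Exports.
Local Open Scope classical_set_scope.
Local Open Scope ring_scope.

Section defs.
Context {R : realType}.
Implicit Types (u f : R -> R) (p s t : R).

(* Euler's integral; it is finite for 0 < s, and only s >= 1/2 is used. *)
Definition Gamma s : R :=
  \int[lebesgue_measure]_(t in `]0, +oo[) (t `^ (s - 1) * expR (- t)).

Definition omega (beta : R) : R :=
  2 * pi `^ ((1 + beta) / 2) / Gamma ((1 + beta) / 2).

(* The integral of f over (0, oo) against omega_beta x^beta dx. *)
Definition lambda_integral (beta : R) f : \bar R :=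
  \int[lebesgue_measure]_(x in `]0, +oo[) (f x * (omega beta * x `^ beta))%:E.

Definition Lp_norm (beta p : R) u : \bar R :=
  (lambda_integral beta (fun x => (`|u x| `^ p)%R) `^ p^-1)%E.

Definition in_Lp (beta p : R) u : Prop :=
  measurable_fun (`]0, +oo[ : set R) u /\ (Lp_norm beta p u < +oo)%E.

Definition absolutely_continuous (a b : R) u : Prop :=
  forall eps : R, 0 < eps -> exists2 delta : R, 0 < delta &
    forall (n : nat) (l r : 'I_n -> R),
      (forall i, [/\ a <= l i, l i <= r i & r i <= b]) ->
      trivIset setT (fun i => `]l i, r i[%classic) ->
      \sum_(i < n) (r i - l i) < delta ->
      \sum_(i < n) `|u (r i) - u (l i)| < eps.

Definition locally_absolutely_continuous u : Prop :=
  forall a b : R, 0 < a -> a <= b -> absolutely_continuous a b u.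

(* Functions on (0, oo) are total functions on R whose values outside (0, oo)
   are irrelevant.  A locally absolutely continuous u is differentiable almost
   everywhere; the library's derivative derive1 u is total and takes a default value
   on the negligible set where u is not differentiable. *)
Definition in_W (alpha theta p : R) u : Prop :=
  [/\ locally_absolutely_continuous u,
      in_Lp theta p u,
      in_Lp alpha p (derive1 u) &
      u x @[x --> +oo] --> (0 : R)].

Definition W_norm (alpha theta p : R) u : \bar R :=
  ((Lp_norm alpha p (derive1 u) `^ p + Lp_norm theta p u `^ p) `^ p^-1)%E.

(* The largest integer strictly less than p (unlike Num.floor p). *)
Definition strict_floor p : int := Num.ceil p - 1.

(* In the sum j runs up to strict_floor p - 1 inclusive; the absolute value only
   converts to nat, since strict_floor p >= 1 when p >= 2. *)
Definition truncated_exp (p mu t : R) : R :=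
  expR (mu * t `^ (p / (p - 1)))
  - \sum_(0 <= j < `|strict_floor p|%N)
      mu ^+ j / j`!%:R * t `^ (p / (p - 1) * j%:R).

Definition mu_crit (alpha theta : R) : R :=
  (1 + theta) * omega alpha `^ (1 / alpha).

End defs.

(* Main.v *)
Require Import Defs.
From HB Require Import structures.
From mathcomp Require Import all_boot all_order all_algebra.
From mathcomp Require Import all_classical all_reals all_analysis.
From mathcomp Require Import measurable_realfun.
From mathcomp Require Import ring lra.
Import Order.TTheory GRing.Theory Num.Theory.
Import numFieldNormedType.Exports.
Set Implicit Arguments.
Unset Strict Implicit.
Unset Printing Implicit Defensive.
Local Open Scope classical_set_scope.
Local Open Scope ring_scope.

(** Write [alpha = p - 1], [q = p / (p - 1)], [w = omega (p - 1)], so that the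
    critical value of [mu] is [(1 + th) * w `^ (p - 1)^-1].

    Bound for [mu] at most critical.  Where [|u|] is bounded the integrand is at
    most a constant times [|u| `^ p], because the first power that survives in
    the truncated series has exponent at least [p]; the norm controls that part.
    The danger is at [x -> 0].  Hoelder's inequality against [dx / x] gives

      [w `^ p^-1 * |u y - u x| <= E x y `^ p^-1 * (ln y - ln x) `^ q^-1]

    with [E x y] the gradient energy of [u] on [(x, y)].  In the logarithmic
    time [t = (1 + th) * ln (x0 / x) + c], with [f] the multiple of [|u|] for
    which [f `^ q] is [|u| `^ q] times the critical value, this yields
    [f `^ q <= t] as the total energy is at most [1].  The measure
    [expR (f `^ q) * x `^ th dx] is then a constant times
    [expR (- (t - f `^ q)) dx / x], and the crude bound [t - f `^ q >= 0] just
    misses integrability.  What saves the critical case is Moser's observation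
    that the deficit [t - f `^ q] cannot stay small for long ([energy_gap]): if
    it is at most [l] at two late times, nearly all the energy was spent before
    the first one, so the rest cannot carry [f] much further and the two times
    are [O(l)] apart.  The times of deficit at most [n + 1] thus fill a set of
    length [O(n + 1)], and summing against [expR (- n)] gives a uniform bound
    ([moser_layers]).

    The function need not vanish at the starting point [x0].  Choosing [x0] in
    [[1, 2]] where [|u|] is least makes [|u x0| `^ p] at most a multiple of the
    energy [N] of the values of [u] ([exists_small_value]); the concavity of
    Hoelder's bound ([hoelder_sum]) lets this initial value be treated as energy
    [N] spent during a fixed preliminary time [c] ([moser_core]).  Hence the
    normalisation of the full norm, gradient plus values, is exactly the
    constraint that is needed.

    For the Hoelder estimate, absolute continuity must give
    [|u b - u a| <= \int |u'|] ([ac_le_int_derive]).  The total variation [V] of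
    [u] and [V - u] are nondecreasing, their Stieltjes measures are dominated by
    the Lebesgue measure, and Lebesgue's differentiation theorem identifies
    their Radon-Nikodym densities with the derivatives almost everywhere.

    Failure for larger [mu].  Moser's functions [min L (max 0 (- ln x))] have
    gradient energy [w * L] and bounded energy of values.  Once normalised, on
    [(0, expR (- L))] they make the exponent at least [kap * L] for some
    [kap > 1 + th], while this interval has measure of the order of
    [expR (- (1 + th) * L)] ([moser_sharp]). *)

(** * Absolute continuity and total variation *)

Section absolute_continuity.
Context {R : realType}.
Implicit Types (a b c d e : R) (u F : R -> R) (x y : R * R) (s : seq (R * R)).

(** Intervals are pairs (right end, left end): this is the order in which
    [zip t (a :: t)] lists the consecutive intervals of a subdivision [t]. *)
Definition subitv a b x := [&& a <= x.2, x.2 <= x.1 & x.1 <= b].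
Definition disjitv x y := (x.1 <= y.2) || (y.1 <= x.2).

Lemma absolutely_continuous_seq a b u : absolutely_continuous a b u ->
  forall e, 0 < e -> exists2 d, 0 < d & forall s,
    all (subitv a b) s -> pairwise disjitv s ->
    \sum_(x <- s) (x.1 - x.2) < d -> \sum_(x <- s) `|u x.1 - u x.2| < e.
Proof.
move=> acu e e0; have [d d0 H] := acu e e0; exists d => // s sab sd.
rewrite !(big_nth (a, a)) !big_mkord => slt.
apply: (H (size s) (fun i => (nth (a, a) s i).2) (fun i => (nth (a, a) s i).1)) => //.
  by move=> i; have /(all_nthP (a, a))/(_ i (ltn_ord i))/and3P[] := sab.
have H2 (i j : nat) : (i < j < size s)%N -> forall z,
    ~ ([set` `](nth (a, a) s i).2, (nth (a, a) s i).1[] z /\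
       [set` `](nth (a, a) s j).2, (nth (a, a) s j).1[] z).
  move=> /andP[ij js] z /=; rewrite !in_itv/= => -[/andP[zi1 zi2] /andP[zj1 zj2]].
  have /(pairwiseP (a, a))/(_ i j) := sd.
  rewrite !inE (ltn_trans ij js) js => /(_ isT isT ij)/orP[] h; lra.
move=> i j _ _ [z [zi zj]]; apply: val_inj.
have [ij|ji|//] := ltngtP (val i) (val j).
- by case: (H2 i j _ z); rewrite ?ij ?ltn_ord.
- by case: (H2 j i _ z); rewrite ?ji ?ltn_ord.
Qed.

Lemma disjitvC x y : disjitv x y = disjitv y x.
Proof. by rewrite /disjitv orbC. Qed.

Lemma subitv_disjitv c d x y : subitv c d x -> disjitv (d, c) y -> disjitv x y.
Proof.
by rewrite /disjitv => /and3P[cx _ xd] /orP[/= h|/= h]; apply/orP; [left|right]; lra.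
Qed.

Lemma zip_partition c (t : seq R) : path <%R c t ->
  let s := zip t (c :: t) in
  [/\ all (subitv c (last c t)) s, pairwise disjitv s &
      \sum_(x <- s) (x.1 - x.2) = last c t - c].
Proof.
elim: t c => [|y t IH] c /=; first by rewrite big_nil subrr.
move=> /andP[cy yt]; have [/= IH1 IH2 IH3] := IH y yt.
have yl : y <= last y t.
  have := order_path_min (@lt_trans _ _) yt.
  move=> /allP h; have := mem_last y t; rewrite inE => /predU1P[->//|/h].
  exact: ltW.
split.
- rewrite /subitv/= lexx (ltW cy) yl/=; apply: sub_all IH1 => x /and3P[h1 h2 h3].
  by rewrite /subitv h2 h3 (le_trans (ltW cy) h1).
- rewrite IH2 andbT; apply: sub_all IH1 => x /and3P[h1 h2 h3].
  by rewrite /disjitv/= h1.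
- by rewrite big_cons IH3/=; ring.
Qed.

(** Absolute continuity controls sums of variations and not only of increments,
    because a variation is a supremum of increments over finer intervals that have
    the same total length. *)
Lemma sum_total_variation_le a b u : absolutely_continuous a b u ->
  forall e, 0 < e -> exists2 d, 0 < d & forall s,
    all (subitv a b) s -> pairwise disjitv s ->
    \sum_(x <- s) (x.1 - x.2) < d ->
    (\sum_(x <- s) total_variation x.2 x.1 u <= e%:E)%E.
Proof.
move=> acu e e0; have [d d0 H] := absolutely_continuous_seq acu e0; exists d => // s.
(* The intervals of s are subdivided one after the other and moved to s', which
   collects plain increments; at the end only increments remain. *)
suff : forall s', all (subitv a b) (s ++ s') -> pairwise disjitv (s ++ s') ->
    \sum_(x <- s ++ s') (x.1 - x.2) < d ->
    (\sum_(x <- s) total_variation x.2 x.1 u +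
     (\sum_(x <- s') `|u x.1 - u x.2|)%:E <= e%:E)%E.
  by move=> /(_ [::]); rewrite cats0 big_nil adde0.
elim: s => [|[r l] s IH] s'.
  by rewrite big_nil add0e => h1 h2 h3; rewrite lee_fin ltW// H.
rewrite !cat_cons [all _ (_ :: _)]/= pairwise_cons big_cons => /andP[rl h1] /andP[h2 h3] h4.
have h4' : \sum_(x <- s ++ s') (x.1 - x.2) < d.
  by apply: le_lt_trans h4; rewrite lerDr subr_ge0; case/and3P: rl.
have IH0 := IH s' h1 h3 h4'.
rewrite big_cons/= -addeA.
move: IH0; set X := (X in (X <= _)%E) => IH0.
have X0 : (0 <= X)%E.
  rewrite /X adde_ge0//; last by rewrite lee_fin sumr_ge0.
  rewrite big_seq sume_ge0// => x xs; apply: total_variation_ge0.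
  by move: h1; rewrite all_cat => /andP[/allP/(_ x xs)/and3P[]].
have Xf : X \is a fin_num by rewrite ge0_fin_numE// (le_lt_trans IH0) ?ltry.
case/and3P: rl => /= al lr rb.
move: lr; rewrite le_eqVlt => /predU1P[lr|lr].
  by rewrite lr total_variationxx add0e.
rewrite -leeBrDr//; apply: ge_ereal_sup => _ [_ [t [tp /eqP tl] <-] <-].
rewrite leeBrDr// (@variation_zip _ _ _ _ t); last by split => //; apply/eqP.
have [/= t1 t2 t3] := zip_partition tp; rewrite tl in t1 t3.
have := IH (zip t (l :: t) ++ s').
rewrite [(\sum_(x <- zip _ _ ++ s') _)%R]big_cat/= EFinD addeCA; apply.
- move: h1; rewrite !all_cat => /andP[-> ->]; rewrite andbT/=.
  apply: sub_all t1 => x /and3P[? ? ?]; apply/and3P; split=> //; lra.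
- move: h2 h3; rewrite !all_cat !pairwise_cat => /andP[k1 k2] /and3P[k3 k4 k5].
  rewrite k4 k5 t2/= !andbT allrel_catr k3 andbT; apply/andP; split.
    apply/allrelP => x y xs yt; rewrite disjitvC.
    apply: (@subitv_disjitv l r); first exact: (allP t1).
    exact: (allP k1).
  apply/allrelP => x y xs yt; apply: (@subitv_disjitv l r).
    exact: (allP t1).
  exact: (allP k2).
- move: h4; rewrite !big_cat/= t3; lra.
Qed.

Lemma ac_total_variation_lty a b u : a <= b -> absolutely_continuous a b u ->
  (total_variation a b u < +oo)%E.
Proof.
move=> ab acu; have [d d0 H] := sum_total_variation_le acu ltr01.
have d20 : 0 < d / 2 by rewrite divr_gt0.
(* The variation over each piece of length d / 2 is at most 1. *)
suff : forall n c, a <= c -> c <= b -> c <= a + n%:R * (d / 2) ->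
    (total_variation a c u < +oo)%E.
  apply; [exact: ab|exact: lexx|].
  apply: (_ : b <= a + (Num.bound ((b - a) / (d / 2)))%:R * (d / 2)).
  rewrite -lerBlDl -ler_pdivrMr//; apply/ltW/archi_boundP.
  by rewrite divr_ge0 ?subr_ge0// ltW.
elim=> [|n IH] c ac cb; rewrite ?mul0r ?addr0 => cn.
  by rewrite (@le_anti _ _ c a) ?cn ?ac// total_variationxx ltry.
pose m := Order.max a (c - d / 2).
have am : a <= m by rewrite le_max lexx.
have mc : m <= c by rewrite ge_max ac/=; lra.
rewrite (total_variationD _ am mc) lte_add_pinfty//.
  apply: IH => //; first by rewrite (le_trans mc).
  rewrite ge_max; apply/andP; split; first by rewrite lerDl mulr_ge0// ltW.
  by move: cn; rewrite -natr1 mulrDl; lra.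
have := H [:: (c, m)]; rewrite !big_seq1/= => /(_ _ isT) h.
apply: le_lt_trans (ltry 1); apply: h.
  by rewrite /subitv/= am mc cb.
have : c - d / 2 <= m by rewrite le_max lexx orbT.
lra.
Qed.

Lemma ac_continuous a b u : absolutely_continuous a b u -> {within `[a, b], continuous u}.
Proof.
move=> acu; apply/subspace_continuousP => x /= xab.
apply/cvgrPdist_lt => e e0; have [d d0 H] := absolutely_continuous_seq acu e0.
rewrite near_withinE; near=> y => yab.
have yx : `|x - y| < d by near: y; exact: cvgr_dist_lt.
have {}yab : y \in `[a, b] by [].
move: xab yab; rewrite !in_itv/= => /andP[ax xb] /andP[ay yb].
have [xy|xy] := leP x y.
  have := H [:: (y, x)]; rewrite !big_seq1/= distrC; apply=> //.
    by rewrite /subitv/= ax xy yb.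
  by move: yx; rewrite distrC ger0_norm// subr_ge0.
have := H [:: (x, y)]; rewrite !big_seq1/=; apply=> //.
  by rewrite /subitv/= ay (ltW xy) xb.
by move: yx; rewrite ger0_norm// subr_ge0 ltW.
Unshelve. all: by end_near. Qed.

End absolute_continuity.

(** * Stieltjes measures dominated by the Lebesgue measure *)

Section stieltjes.
Context {R : realType}.
Implicit Types (a b c d e : R) (s : seq (R * R)).
Local Notation leb := (@lebesgue_measure R).

(** The components of an open set are only known to be open and order-convex;
    this turns those of finite measure into explicit intervals. *)
Lemma open_intervalE (I : set R) : open I -> is_interval I -> I !=set0 ->
  (leb I < +oo)%E -> exists c d, c < d /\ I = `]c, d[%classic.
Proof.
move=> oI iI [z Iz] Ioo; have := (is_intervalP I).1 iI.
have inf_notin : has_lbound I -> ~ I (inf I).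
  move=> lI Ii; have /nbhs_ballP[e /= e0 eI] := open_nbhs_nbhs (conj oI Ii).
  have : inf I <= inf I - e / 2.
    apply: ge_inf => //; apply: eI; rewrite /ball/= opprB addrC subrK.
    by rewrite gtr0_norm ?divr_gt0// ltr_pdivrMr// ltr_pMr// ltr1n.
  by rewrite leNgt ltrBlDr ltrDl divr_gt0.
have sup_notin : has_ubound I -> ~ I (sup I).
  move=> lI Ii; have /nbhs_ballP[e /= e0 eI] := open_nbhs_nbhs (conj oI Ii).
  have : sup I + e / 2 <= sup I.
    apply: ub_le_sup => //; apply: eI; rewrite /ball/= opprD addrA subrr add0r normrN.
    by rewrite gtr0_norm ?divr_gt0// ltr_pdivrMr// ltr_pMr// ltr1n.
  by rewrite leNgt ltrDl divr_gt0.
rewrite /Rhull; case: (asboolP (has_lbound I)) => [lI|nlI];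
  case: (asboolP (has_ubound I)) => [uI|nuI].
- rewrite asboolF; last exact: inf_notin.
  rewrite asboolF; last exact: sup_notin.
  move=> IE; exists (inf I), (sup I); split; last exact: IE.
  by have := Iz; rewrite [X in X z -> _]IE/= in_itv/= => /andP[h1 h2]; apply: lt_trans h1 h2.
- by move=> IE; move: Ioo; rewrite [in X in X -> _]IE lebesgue_measure_itv/= ltry ltxx.
- by move=> IE; move: Ioo; rewrite [in X in X -> _]IE lebesgue_measure_itv/= ltNyr ltxx.
- by move=> IE; move: Ioo; rewrite [in X in X -> _]IE lebesgue_measure_itv/= ltxx.
Qed.

Lemma stieltjes_itvoc (F : cumulative R R) c d : c <= d ->
  lebesgue_stieltjes_measure F `]c, d]%classic = (F d - F c)%:E.
Proof.
move=> cd; rewrite /lebesgue_stieltjes_measure /measure_extension.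
by rewrite measurable_mu_extE/=; [rewrite wlength_itv_bnd|exact: is_ocitv].
Qed.

(** For a nondecreasing [F] this is absolute continuity on the whole line, so
    the increments carry no absolute value. *)
Definition sums_small F := forall e, 0 < e -> exists2 d, 0 < d & forall s,
  all (fun x => x.2 <= x.1) s -> pairwise disjitv s ->
  \sum_(x <- s) (x.1 - x.2) < d -> \sum_(x <- s) (F x.1 - F x.2) <= e.

(** A Lebesgue-null set lies in an open set of small Lebesgue measure.  The
    components of that open set are disjoint intervals of small total length, over
    which the increments of [F], that is its Stieltjes measure, sum to little. *)
Lemma stieltjes_dominates (F : cumulative R R) : sums_small F ->
  lebesgue_stieltjes_measure F `<< leb.
Proof.
move=> smF; apply/null_content_dominatesP => A mA A0.
apply/eqP; rewrite eq_le measure_ge0 andbT; apply/lee_addgt0Pr => e e0; rewrite add0e.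
have [d d0 H] := smF e e0.
have [|U [oU AU Ud]] := lebesgue_regularity_outer mA _ d0; first by rewrite A0 ltry.
have {}Ud : (leb U < d%:E)%E.
  rewrite -(setDUK AU) measureU//; last 2 first.
  - by apply: measurableD => //; exact: open_measurable.
  - by rewrite setDIK.
  by rewrite A0 add0e.
apply: (@le_trans _ _ (lebesgue_stieltjes_measure F U)).
  by apply: le_measure; rewrite ?inE//; exact: open_measurable.
pose I := open_disjoint_itv oU.
have mI i : measurable (I i) by apply: open_measurable; exact: open_disjoint_itv_open.
have UI : U = \bigcup_i I i by exact: open_disjoint_itv_bigcup.
have tI : trivIset setT I := open_disjoint_itv_trivIset (oU := oU).
have mU : measurable (\bigcup_i I i) by rewrite -UI; exact: open_measurable.
rewrite UI measure_semi_bigcup//.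
apply: lime_le; first exact: is_cvg_nneseries.
apply: nearW => n.
have sumI : (\sum_(0 <= i < n) leb (I i) < d%:E)%E.
  apply: le_lt_trans Ud; rewrite UI.
  rewrite [leRHS]measure_semi_bigcup//.
  exact: nneseries_lim_ge.
(* An empty component is encoded by the degenerate interval (0, 0). *)
have cdI i : exists x : R * R, x.2 <= x.1 /\
    ((x.2 = x.1 /\ I i = set0) \/ (x.2 < x.1 /\ I i = `]x.2, x.1[%classic)).
  have [I0|/set0P I0] := eqVneq (I i) set0; first by exists (0, 0); split => //; left.
  have [| | |c [d' [cd IE]]] := @open_intervalE (I i) _ _ I0.
  - exact: open_disjoint_itv_open.
  - exact: open_disjoint_itv_is_interval.
  - apply: le_lt_trans (lt_trans Ud (ltry d)); apply: le_measure; rewrite ?inE;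
      [exact: mI|exact: open_measurable|].
    by rewrite UI; exact: bigcup_sup.
  by exists (d', c); split; [exact: ltW|right].
have [g gI] := choice cdI.
have lebI i : leb (I i) = ((g i).1 - (g i).2)%:E.
  have [_ [[-> ->]|[h ->]]] := gI i; first by rewrite measure0 subrr.
  by rewrite lebesgue_measure_itv/= lte_fin h EFinB.
have lsI i : (lebesgue_stieltjes_measure F (I i) <= (F (g i).1 - F (g i).2)%:E)%E.
  have [_ [[-> ->]|[h ->]]] := gI i; first by rewrite measure0 subrr.
  rewrite -stieltjes_itvoc; last exact: ltW.
  by apply: le_measure; rewrite ?inE//; exact: subset_itv_oo_oc.
have disjg i j : i != j -> (g i).2 < (g i).1 -> (g j).2 < (g j).1 ->
    disjitv (g i) (g j).
  move=> ij gi gj.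
  have [_ [[gi' _]|[_ Ii]]] := gI i; first by rewrite gi' ltxx in gi.
  have [_ [[gj' _]|[_ Ij]]] := gI j; first by rewrite gj' ltxx in gj.
  rewrite /disjitv; apply/orP.
  have [h|h] := leP (g i).1 (g j).2; first by left.
  have [h'|h'] := leP (g j).1 (g i).2; first by right.
  (* Two overlapping intervals would share the midpoint of their overlap. *)
  pose z := (Order.max (g i).2 (g j).2 + Order.min (g i).1 (g j).1) / 2.
  suff [zi zj] : I i z /\ I j z.
    by move: ij => /eqP[]; apply: tI => //; exists z.
  have lt1 : Order.max (g i).2 (g j).2 < Order.min (g i).1 (g j).1.
    by rewrite gt_max !lt_min gi gj h h'.
  have [k1 k2] := midf_lt lt1.
  move: k1 k2; rewrite -/z gt_max lt_min => /andP[k1 k2] /andP[k3 k4].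
  by rewrite Ii Ij/= !in_itv/= k1 k2 k3 k4.
apply: (@le_trans _ _ (\sum_(0 <= i < n) (F (g i).1 - F (g i).2))%:E).
  by rewrite -sumEFin; apply: lee_sum => i _; exact: lsI.
rewrite lee_fin.
pose P i := (g i).2 < (g i).1.
have gE i : ~~ P i -> (g i).1 = (g i).2.
  by have [h _] := gI i; rewrite -leNgt => h'; apply/le_anti/andP.
have filterE (G : R -> R) : \sum_(0 <= i < n) (G (g i).1 - G (g i).2) =
    \sum_(x <- [seq g i | i <- iota 0 n & P i]) (G x.1 - G x.2).
  rewrite big_map big_filter (bigID P)/= [X in _ + X]big1 ?addr0 ?/index_iota ?subn0//.
  by move=> i /gE ->; rewrite subrr.
rewrite filterE; apply: H.
- by apply/allP => x /mapP[i _ ->]; have [] := gI i.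
- rewrite pairwise_map; have := iota_uniq 0 n; rewrite uniq_pairwise.
  move=> /(pairwise_filter P); apply: (@sub_in_pairwise _ P); last exact: filter_all.
  by move=> i j Pi Pj ij; exact: disjg.
- rewrite -(filterE id); move: sumI; under eq_bigr do rewrite lebI.
  by rewrite sumEFin lte_fin /index_iota subn0.
Qed.

End stieltjes.

(** * Derivatives of absolutely continuous functions *)

Section density.
Context {R : realType}.
Implicit Types (a b c d e : R) (s : seq (R * R)) (u F : R -> R).
Local Notation leb := (@lebesgue_measure R).

Lemma sums_small_right_continuous F : nondecreasing F -> sums_small F -> right_continuous F.
Proof.
move=> ndF smF x; apply/cvgrPdist_le => e e0; have [d d0 H] := smF e e0.
near=> y.
have xy : x < y by near: y; exact: nbhs_right_gt.
rewrite distrC ger0_norm; last by rewrite subr_ge0 ndF// ltW.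
have := H [:: (y, x)]; rewrite !big_seq1/= (ltW xy); apply => //.
by rewrite ltrBlDl; near: y; apply: nbhs_right_lt; rewrite ltrDl.
Unshelve. all: by end_near. Qed.

(** The density is the Radon-Nikodym derivative of the Stieltjes measure of [F]
    restricted to [`]a, b]], which makes it finite; Lebesgue's differentiation
    theorem shows that it is the derivative of [F] almost everywhere. *)
Lemma stieltjes_density F a b : nondecreasing F -> sums_small F -> a < b ->
  exists g : R -> R, [/\ leb.-integrable setT (EFin \o g),
    forall x, a <= x <= b -> F x - F a = \int[leb]_(t in `]a, x]) g t &
    {ae leb, forall x, a < x < b -> is_derive x 1 F (g x)}].
Proof.
move=> ndF smF ab; have rcF := sums_small_right_continuous ndF smF.
pose Fc : cumulative R R :=
  HB.pack_for (cumulative R R) F (isCumulative.Build R _ R F ndF rcF).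
have nuab : (lebesgue_stieltjes_measure Fc `]a, b]%classic < +oo)%E.
  by rewrite stieltjes_itvoc ?ltry// ltW.
have mab : measurable (`]a, b]%classic : set (measurableTypeR R)) by exact: measurable_itv.
pose nu := mfrestr mab nuab.
have nuleb : nu `<< leb.
  apply/null_content_dominatesP => A mA A0; apply/eqP.
  rewrite eq_le measure_ge0 andbT.
  have /null_content_dominatesP/(_ A mA A0) <- := stieltjes_dominates (F := Fc) smF.
  apply: le_measure; rewrite ?inE//; exact: measurableI.
have [f [f0 ffin fint fE]] := radon_nikodym_sigma_finite nuleb.
pose g := fine \o f.
have gf : EFin \o g = f by apply/funext => x; rewrite /= fineK.
have intE A : measurable A -> (\int[leb]_(x in A) (g x)%:E = nu A)%E.
  move=> mA; transitivity (\int[leb]_(x in A) f x)%E; last by rewrite -fE.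
  by apply: eq_integral => x _; rewrite /g/= fineK.
have FE x : a <= x <= b -> F x - F a = \int[leb]_(t in `]a, x]) g t.
  move=> /andP[ax xb]; rewrite /Rintegral intE// /nu /mfrestr /mrestr setIidl; last first.
    by apply: subset_itvl; rewrite bnd_simp.
  by rewrite (stieltjes_itvoc Fc).
exists g; split => //; first by rewrite gf.
have := @FTC1 R g (BRight a); rewrite gf => /(_ (fun y => integrableS measurableT _ _ fint)).
case => //.
  apply: open_integrable_locally => //; [exact: openT|by rewrite gf].
move=> N [mN N0 sN]; exists N; split => // x /= /not_implyP[/andP[ax xb] nd].
apply: sN => /= dGE; have [dG GE] := dGE ax.
apply: nd.
have near_eq : \forall y \near x, F a + \int[leb]_(t in `]a, y]) g t = F y.
  near=> y; rewrite -FE ?[F a + _]addrC ?subrK//; apply/andP; split.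
    by apply/ltW; near: y; exact: lt_nbhsr.
  by apply/ltW; near: y; exact: lt_nbhsl.
apply: near_eq_is_derive near_eq _.
move: dG GE; set G := (fun x => \int[leb]_(t in _) g t) => dG GE.
rewrite derive1E in GE; have isG := DeriveDef dG GE.
have -> : (fun y => F a + G y) = cst (F a) + G by [].
have := is_deriveD (is_derive_cst (F a) x 1) isG.
by rewrite add0r.
Unshelve. all: by end_near. Qed.

End density.

Section ac_ftc.
Context {R : realType}.
Implicit Types (a b c d e : R) (s : seq (R * R)) (u F : R -> R).
Local Notation leb := (@lebesgue_measure R).

(** Precomposition with [clamp a b] extends a function on [[a, b]] by constants,
    as a Stieltjes measure requires a function on the whole line. *)
Definition clamp a b x := Order.max a (Order.min x b).

Lemma clamp_itv a b x : a <= b -> a <= clamp a b x <= b.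
Proof. by move=> ab; rewrite /clamp le_max lexx/= ge_max ab/= ge_min lexx orbT. Qed.

Lemma clamp_homo a b x y : x <= y -> clamp a b x <= clamp a b y.
Proof. by move=> xy; rewrite /clamp /Order.max /Order.min; do ?case: ifPn; lra. Qed.

Lemma clamp_dist a b x y : a <= b -> x <= y -> clamp a b y - clamp a b x <= y - x.
Proof. by move=> ab xy; rewrite /clamp /Order.max /Order.min; do ?case: ifPn; lra. Qed.

Lemma clamp_id a b x : a <= x <= b -> clamp a b x = x.
Proof. by move=> axb; rewrite /clamp /Order.max /Order.min; do ?case: ifPn; lra. Qed.

(** The factor [2] serves both the variation function [V] and [V - u], whose
    increments are at most twice those of [V]. *)
Lemma sums_small_clamp a b u F : a <= b -> absolutely_continuous a b u ->
  (forall x y, x <= y ->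
    F y - F x <= 2 * fine (total_variation (clamp a b x) (clamp a b y) u)) ->
  (forall x y, a <= x -> x <= y -> y <= b -> total_variation x y u \is a fin_num) ->
  sums_small F.
Proof.
move=> ab acu FTV TVfin e e0.
have e20 : 0 < e / 2 by rewrite divr_gt0.
have [d d0 H] := sum_total_variation_le acu e20; exists d => // s s21 ds sd.
pose cl x : R * R := (clamp a b x.1, clamp a b x.2).
have TVf x : x.2 <= x.1 -> total_variation (clamp a b x.2) (clamp a b x.1) u \is a fin_num.
  move=> x21; have /andP[h1 _] := clamp_itv x.2 ab; have /andP[_ h2] := clamp_itv x.1 ab.
  by apply: TVfin => //; exact: clamp_homo.
apply: (@le_trans _ _ (2 * \sum_(x <- s) fine (total_variation (clamp a b x.2) (clamp a b x.1) u))).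
  rewrite mulr_sumr big_seq [leRHS]big_seq; apply: ler_sum => x xs.
  by apply: FTV; exact: (allP s21).
rewrite mulrC -ler_pdivlMr// -lee_fin -sumEFin.
have -> : (\sum_(x <- s) (fine (total_variation (clamp a b x.2) (clamp a b x.1) u))%:E =
    \sum_(x <- map cl s) total_variation x.2 x.1 u)%E.
  rewrite big_map big_seq [RHS]big_seq; apply: eq_bigr => x xs; rewrite fineK//.
  by apply: TVf; exact: (allP s21).
apply: H.
- apply/allP => _ /mapP[x xs ->]; rewrite /subitv/=.
  have /andP[-> _] := clamp_itv x.2 ab; have /andP[_ ->] := clamp_itv x.1 ab.
  by rewrite clamp_homo//; exact: (allP s21).
- rewrite pairwise_map; apply: sub_pairwise ds => x y; rewrite /disjitv/=.
  by move=> /orP[h|h]; apply/orP; [left|right]; exact: clamp_homo.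
- apply: le_lt_trans sd; rewrite big_map big_seq [leRHS]big_seq; apply: ler_sum => x xs.
  by apply: clamp_dist => //; exact: (allP s21).
Qed.

(** Jordan decomposition: [u = V - (V - u)] with [V] the variation of [u] is a
    difference of nondecreasing functions, each of which has a density. *)
Lemma ac_density a b u : a < b -> absolutely_continuous a b u ->
  exists g : R -> R, [/\ leb.-integrable setT (EFin \o g),
    u b - u a = \int[leb]_(t in `]a, b]) g t &
    {ae leb, forall x, a < x < b -> is_derive x 1 u (g x)}].
Proof.
move=> ltab acu; have ab := ltW ltab.
have TVfin x y : a <= x -> x <= y -> y <= b -> total_variation x y u \is a fin_num.
  move=> ax xy yb; rewrite ge0_fin_numE; last exact: total_variation_ge0.
  apply: le_lt_trans (ac_total_variation_lty ab acu).
  rewrite (total_variationD u ax (le_trans xy yb)) (total_variationD u xy yb).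
  rewrite addeCA leeDl// adde_ge0// total_variation_ge0//.
pose V x := fine (total_variation a (clamp a b x) u).
have VE x y : x <= y -> V y - V x = fine (total_variation (clamp a b x) (clamp a b y) u).
  move=> xy; have cxy := clamp_homo a b xy.
  have /andP[ax xb] := clamp_itv x ab; have /andP[ay yb] := clamp_itv y ab.
  rewrite /V (total_variationD u ax cxy) fineD ?TVfin//; ring.
have Vu x y : x <= y -> `|u (clamp a b y) - u (clamp a b x)| <= V y - V x.
  move=> xy; have cxy := clamp_homo a b xy.
  have /andP[ax xb] := clamp_itv x ab; have /andP[ay yb] := clamp_itv y ab.
  by rewrite VE// -lee_fin fineK ?TVfin//; exact: total_variation_ge.
pose W x := V x - u (clamp a b x).
have ndV : nondecreasing V.
  by move=> x y xy; rewrite -subr_ge0; exact: le_trans (Vu _ _ xy).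
have ndW : nondecreasing W.
  move=> x y xy; have := Vu _ _ xy; rewrite ler_norml /W => /andP[]; lra.
have smV : sums_small V.
  apply: (sums_small_clamp ab acu _ TVfin) => x y xy.
  by rewrite -VE//; have := le_trans (normr_ge0 _) (Vu _ _ xy); lra.
have smW : sums_small W.
  apply: (sums_small_clamp ab acu _ TVfin) => x y xy.
  by rewrite -VE//; have := Vu _ _ xy; rewrite ler_norml /W => /andP[]; lra.
have [g1 [g1i g1E g1d]] := stieltjes_density ndV smV ltab.
have [g2 [g2i g2E g2d]] := stieltjes_density ndW smW ltab.
exists (g1 \- g2); split.
- have -> : EFin \o (g1 \- g2) = (fun x => (g1 x)%:E - (g2 x)%:E)%E by apply/funext.
  exact: integrableB.
- rewrite RintegralB//; last 2 first.
    exact: integrableS g1i.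
    exact: integrableS g2i.
  rewrite -g1E ?ab ?lexx// -g2E ?ab ?lexx// /W !clamp_id ?lexx ?ab//; ring.
- apply: filterS2 g1d g2d; first exact: (ae_filter_ringOfSetsType leb).
  move=> x d1 d2 axb.
  have := is_deriveB (d1 axb) (d2 axb).
  apply: near_eq_is_derive; case/andP: axb => ax xb.
  near=> y; rewrite /= /W fctE opprB addrC subrK clamp_id//; apply/andP; split.
    by apply/ltW; near: y; exact: lt_nbhsr.
  by apply/ltW; near: y; exact: lt_nbhsl.
Unshelve. all: by end_near. Qed.

(** The increment is the integral of the density of [ac_density], which agrees
    with [derive1 u] almost everywhere. *)
Lemma ac_le_int_derive a b u : a <= b -> absolutely_continuous a b u ->
  measurable_fun `[a, b] (derive1 u) ->
  (`|u b - u a|%:E <= \int[leb]_(x in `]a, b]) `|derive1 u x|%:E)%E.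
Proof.
rewrite le_eqVlt => /predU1P[<-|ab] acu mu.
  by rewrite subrr normr0 integral_ge0.
have [g [gi -> gd]] := ac_density ab acu.
have gS : leb.-integrable `]a, b]%classic (EFin \o g) by exact: integrableS gi.
apply: (@le_trans _ _ (\int[leb]_(x in `]a, b]) `|g x|%:E)%E).
  rewrite /Rintegral -fine_abse; last exact: integrable_fin_num.
  rewrite fineK; last by rewrite abse_fin_num; exact: integrable_fin_num.
  by apply: le_abse_integral => //; case/integrableP: gS.
have mS : measurable_fun `]a, b] (derive1 u).
  by apply: measurable_funS mu => //; apply: subset_itvr; rewrite bnd_simp.
rewrite le_eqVlt; apply/orP; left; apply/eqP; apply: ae_eq_integral => //.
- apply/measurable_EFinP/measurableT_comp => //; apply/measurable_EFinP.
  by case/integrableP: gS.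
- by apply/measurable_EFinP; exact: measurableT_comp.
have nb : {ae leb, forall x, x != b}.
  exists [set b]; split => //; first exact: lebesgue_measure_set1.
  by move=> x /= /negP; rewrite negbK => /eqP.
apply: filterS2 gd nb; first exact: (ae_filter_ringOfSetsType leb).
move=> x dx xb; rewrite /= in_itv/= => /andP[ax xb'].
have [_] : is_derive x 1 u (g x) by apply: dx; rewrite ax lt_neqAle xb.
by rewrite derive1E => ->.
Qed.

End ac_ftc.

(** * Explicit integrals and the positivity of omega *)

Section integrals.
Context {R : realType}.
Implicit Types (a b x s : R) (f g F : R -> R) (A B D : set R).
Local Notation leb := (@lebesgue_measure R).

Lemma le_integral_EFin D f g : measurable D -> measurable_fun D f ->
  measurable_fun D g -> (forall x, D x -> 0 <= f x <= g x) ->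
  (\int[leb]_(x in D) (f x)%:E <= \int[leb]_(x in D) (g x)%:E)%E.
Proof.
move=> mD mf mg fg; apply: ge0_le_integral => //.
- by move=> x /fg /andP[f0 _]; rewrite lee_fin.
- exact/measurable_EFinP.
- exact/measurable_EFinP.
- by move=> x /fg /andP[_ ?]; rewrite lee_fin.
Qed.

Lemma subset_integral_EFin A B f : measurable A -> measurable B ->
  measurable_fun B f -> (forall x, B x -> 0 <= f x) -> A `<=` B ->
  (\int[leb]_(x in A) (f x)%:E <= \int[leb]_(x in B) (f x)%:E)%E.
Proof.
move=> mA mB mf f0 AB; apply: ge0_subset_integral => //.
exact/measurable_EFinP.
Qed.

Lemma integral_derive f F a b : 0 < a -> a <= b ->
  (forall x, 0 < x -> is_derive x 1 F (f x)) ->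
  (forall x, 0 < x -> {for x, continuous f}) ->
  (\int[leb]_(x in `[a, b]) (f x)%:E = (F b - F a)%:E)%E.
Proof.
move=> a0; rewrite le_eqVlt => /predU1P[<-|ab] dF cf.
  by rewrite set_itv1 integral_set1 subrr.
have cF x : 0 < x -> {for x, continuous F}.
  by move=> /dF[dFx _]; apply/differentiable_continuous/derivable1_diffP.
have b0 := lt_trans a0 ab.
rewrite (@continuous_FTC2 _ f F)//.
- apply: continuous_in_subspaceT => x /[!inE]/=; rewrite in_itv/= => /andP[ax _].
  by apply: cf; exact: lt_le_trans ax.
- split.
  + by move=> x; rewrite in_itv/= => /andP[ax _]; have [] := dF x (lt_trans a0 ax).
  + exact/cvg_at_right_filter/cF.
  + exact/cvg_at_left_filter/cF.
- move=> x; rewrite in_itv/= => /andP[ax _].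
  by rewrite derive1E; have [] := dF x (lt_trans a0 ax).
Qed.

Lemma integral_inv a b : 0 < a -> a <= b ->
  (\int[leb]_(x in `[a, b]) (x^-1)%:E = (ln b - ln a)%:E)%E.
Proof.
move=> a0 ab; apply: (@integral_derive (fun x => x^-1) (@ln R)) => // x x0.
by apply: continuousV; [rewrite gt_eqF|exact: cvg_id].
Qed.

Lemma continuous_powR_gt0 r x : 0 < x -> {for x, continuous (@powR R ^~ r)}.
Proof.
move=> x0; apply/differentiable_continuous/derivable1_diffP.
by apply: derivable_powR; rewrite in_itv/= x0.
Qed.

(** This majorant near [0] serves twice: for Euler's integral with exponent at
    least [- 1/2], and for the powers of the logarithm in Moser's functions.  The
    integral is the increasing limit of those over [[1 / (n + 1), 1]]. *)
Lemma integral_invsqrt :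
  (\int[leb]_(x in `]0%R, 1%R]) (x `^ (- 2^-1))%:E <= 2%:E)%E.
Proof.
pose F n : set R := [set` `[n.+1%:R^-1, 1]].
have FU : \bigcup_n F n = `]0%R, 1%R]%classic.
  apply/seteqP; split => [x [n _]|x]/=; rewrite /F/= !in_itv/=.
    by move=> /andP[nx ->]; rewrite andbT (lt_le_trans _ nx).
  move=> /andP[x0 x1]; exists (Num.bound x^-1) => //=; rewrite in_itv/= x1 andbT.
  rewrite invf_ple ?posrE//; apply/ltW; apply: lt_trans (archi_boundP _) _.
    by rewrite invr_ge0 ltW.
  by rewrite ltr_nat.
have mpow A : measurable A -> measurable_fun A (fun x => (x `^ (- 2^-1))%:E : \bar R).
  by move=> mA; apply/measurable_EFinP/measurable_funTS; exact: measurable_powR.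
have cvgF : (\int[leb]_(x in F i) (x `^ (- 2^-1))%:E @[i --> \oo] -->
    \int[leb]_(x in \bigcup_i F i) (x `^ (- 2^-1))%:E)%E.
  apply: ge0_nondecreasing_set_cvg_integral.
  - move=> m n mn; apply/subsetPset; apply: subset_itvr; rewrite bnd_simp.
    by rewrite lef_pV2 ?posrE// ler_nat.
  - by move=> i; exact: measurable_itv.
  - by move=> i; apply: mpow; exact: measurable_itv.
  - by move=> i x _; rewrite lee_fin powR_ge0.
rewrite -FU -(cvg_lim _ cvgF)//; apply: lime_le; first exact: cvgP cvgF.
apply: nearW => n; rewrite /F.
have n0 : 0 < n.+1%:R^-1 :> R by rewrite invr_gt0.
have n1 : n.+1%:R^-1 <= 1 :> R by rewrite invf_le1// ler1n.
have dF x : 0 < x -> is_derive x 1 (fun y : R => 2 * y `^ 2^-1) (x `^ (- 2^-1)).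
  move=> x0; have := is_deriveZ 2 (is_derive1_powR 2^-1 x0).
  by rewrite /= scalerA mulfV// scale1r; have -> : 2^-1 - 1 = - 2^-1 :> R by lra.
rewrite (integral_derive n0 n1 dF); last by move=> x; exact: continuous_powR_gt0.
by rewrite lee_fin powR1 mulr1 lerBlDr lerDl mulr_ge0// powR_ge0.
Qed.

(** Write [x = (2 * m) * y] with [y = x / (2 * m)] and use [y <= expR y]. *)
Lemma le_powR_expR m x : 0 < m -> 0 < x -> x `^ m <= (2 * m) `^ m * expR (x / 2).
Proof.
move=> m0 x0; have m20 : 0 < 2 * m by rewrite mulr_gt0.
rewrite {1}(_ : x = (2 * m) * (x / (2 * m))); last by field; rewrite gt_eqF.
rewrite powRM; [|exact: ltW|by rewrite divr_ge0// ltW].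
rewrite ler_wpM2l ?powR_ge0//.
have y0 : 0 < x / (2 * m) by rewrite divr_gt0.
rewrite {1}/powR gt_eqF// ler_expR.
have : ln (x / (2 * m)) <= x / (2 * m).
  rewrite -ler_expR lnK ?posrE//.
  by apply: le_trans (expR_ge1Dx _); rewrite lerDr.
move=> h; apply: le_trans (ler_wpM2l (ltW m0) h) _.
by rewrite le_eqVlt; apply/orP; left; apply/eqP; field; rewrite gt_eqF.
Qed.

Lemma Gamma_integrand_le s x : 2^-1 <= s -> 0 < x ->
  x `^ (s - 1) * expR (- x) <=
  x `^ (- 2^-1) * \1_(`]0%R, 1%R]) x + 2 * (2 * s) `^ s * exponential_pdf 2^-1 x.
Proof.
move=> s2 x0; rewrite exponential_pdfE ?(ltW x0)//=.
have e1 : expR (- x) <= 1 by rewrite -expR0 ler_expR; lra.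
have [x1|x1] := leP x 1.
  rewrite indicE mem_set ?mulr1/=; last by rewrite in_itv/= x0 x1.
  rewrite -[leLHS]addr0; apply: lerD; last by rewrite !mulr_ge0 ?powR_ge0 ?expR_ge0.
  rewrite -[leRHS]mulr1; apply: ler_pM; rewrite ?powR_ge0 ?expR_ge0//.
  by apply: ger_powR; rewrite ?x0//; lra.
rewrite indicE memNset ?mulr0 ?add0r/=; last by rewrite in_itv/= x0/= leNgt x1.
have -> : 2 * (2 * s) `^ s * (2^-1 * expR (- 2^-1 * x)) =
    (2 * s) `^ s * expR (- 2^-1 * x) by field.
have xs : x `^ (s - 1) <= (2 * s) `^ s * expR (x / 2).
  apply: le_trans (le_powR_expR _ _) => //; last lra.
  by apply: ler_powR; [exact: ltW|lra].
apply: le_trans (ler_wpM2r (expR_ge0 _) xs) _.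
rewrite -mulrA -expRD le_eqVlt; apply/orP; left; apply/eqP.
by congr (_ * expR _); field.
Qed.

(** The integral that defines [Gamma] is real-valued and would be [0] if it
    diverged, so its finiteness has to be established as well. *)
Lemma Gamma_gt0 s : 2^-1 <= s -> 0 < Gamma s.
Proof.
move=> s2; rewrite /Gamma /Rintegral.
set f := fun t : R => t `^ (s - 1) * expR (- t).
have mf : measurable_fun setT f.
  apply: measurable_funM; first exact: measurable_powR.
  by apply: measurableT_comp => //; exact: measurableT_comp.
have f0 x : 0 <= f x by rewrite mulr_ge0 ?powR_ge0 ?expR_ge0.
apply: fine_gt0; apply/andP; split.
  apply: (@lt_le_trans _ _ (\int[leb]_(x in `[1%R, 2%R]) (expR (- 2) / 2)%:E)%E).
    rewrite integral_cst//= lebesgue_measure_itv/= lte_fin ltr1n/= -EFinD -EFinM.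
    by rewrite lte_fin mulr_gt0 ?divr_gt0 ?expR_gt0//; lra.
  apply: (@le_trans _ _ (\int[leb]_(x in `[1%R, 2%R]) (f x)%:E)%E).
    apply: le_integral_EFin => //; first exact: measurable_funTS.
    move=> x /=; rewrite in_itv/= => /andP[x1 x2].
    rewrite divr_ge0 ?expR_ge0//= /f mulrC.
    apply: ler_pM; rewrite ?invr_ge0 ?expR_ge0//; last by rewrite ler_expR lerN2.
    apply: (@le_trans _ _ (x `^ (-1))).
      by rewrite powR_inv1 ?lef_pV2 ?posrE//; lra.
    by apply: ler_powR => //; lra.
  apply: subset_integral_EFin => //; first exact: measurable_funTS.
  by move=> x /=; rewrite !in_itv/= => /andP[x1 _]; rewrite andbT; lra.
pose g1 x : R := x `^ (- 2^-1) * \1_(`]0%R, 1%R]) x.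
pose g2 x : R := 2 * (2 * s) `^ s * exponential_pdf 2^-1 x.
have mg1 : measurable_fun setT g1.
  by apply: measurable_funM; [exact: measurable_powR|exact: measurable_indic].
have mg2 : measurable_fun setT g2.
  by apply: measurable_funM => //; exact: measurable_exponential_pdf.
have g10 x : 0 <= g1 x by rewrite mulr_ge0 ?powR_ge0// indicE.
have g20 x : 0 <= g2 x.
  by rewrite !mulr_ge0 ?powR_ge0// exponential_pdf_ge0.
apply: (@le_lt_trans _ _ (\int[leb]_(x in setT) (g1 x + g2 x)%:E)%E).
  apply: (@le_trans _ _ (\int[leb]_(x in `]0%R, +oo[) (g1 x + g2 x)%:E)%E).
    apply: le_integral_EFin => //; first exact: measurable_funTS.
      by apply: measurable_funTS; exact: measurable_funD.
    move=> x /=; rewrite in_itv/= andbT => x0; rewrite f0/=.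
    exact: Gamma_integrand_le.
  apply: subset_integral_EFin => //; first exact: measurable_funD.
  by move=> x _; rewrite addr_ge0.
under eq_integral do rewrite EFinD.
rewrite ge0_integralD//; last 4 first.
- by move=> x _; rewrite lee_fin.
- exact/measurable_EFinP.
- by move=> x _; rewrite lee_fin.
- exact/measurable_EFinP.
rewrite lte_add_pinfty//.
  apply: le_lt_trans (ltry 2); apply: le_trans integral_invsqrt.
  rewrite [leRHS]integral_mkcond le_eqVlt; apply/orP; left; apply/eqP.
  apply: eq_integral => x _; rewrite patchE /g1 indicE; case: ifPn => xi.
    by rewrite mulr1.
  by rewrite mulr0.
under eq_integral do rewrite EFinM.
rewrite ge0_integralZl//=; last first.
- by rewrite lee_fin mulr_ge0 ?powR_ge0.
- by move=> x _; rewrite lee_fin exponential_pdf_ge0.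
- by apply/measurable_EFinP; exact: measurable_exponential_pdf.
by rewrite integral_exponential_pdf// mule1 ltry.
Qed.

Lemma omega_gt0 (beta : R) : 0 <= beta -> 0 < omega beta.
Proof.
move=> b0; rewrite /omega divr_gt0//.
  by rewrite mulr_gt0// powR_gt0// pi_gt0.
by apply: Gamma_gt0; lra.
Qed.

End integrals.

(** * Moser's energy gap *)

Section gap.
Context {R : realType} (p : R).
Implicit Types (x y t : R).

Local Notation q := (p / (p - 1)).

Lemma powRVK x r : 0 <= x -> r != 0 -> (x `^ r^-1) `^ r = x.
Proof. by move=> x0 r0; rewrite -powRrM mulVf// powRr1. Qed.

Lemma powRKV x r : 0 <= x -> r != 0 -> (x `^ r) `^ r^-1 = x.
Proof. by move=> x0 r0; rewrite -powRrM mulfV// powRr1. Qed.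

Lemma conjugate_gt0 : 2 <= p -> 0 < q.
Proof. by move=> p2; rewrite divr_gt0//; lra. Qed.

Lemma le_powR x y r : 0 <= r -> 0 <= x -> x <= y -> x `^ r <= y `^ r.
Proof. by move=> r0 x0 xy; rewrite ge0_ler_powR// nnegrE// (le_trans x0). Qed.

Lemma hoelder_sum x1 x2 t1 t2 : 2 <= p -> 0 <= x1 -> 0 <= x2 -> 0 <= t1 -> 0 <= t2 ->
  x1 `^ p^-1 * t1 `^ q^-1 + x2 `^ p^-1 * t2 `^ q^-1 <=
  (x1 + x2) `^ p^-1 * (t1 + t2) `^ q^-1.
Proof.
move=> p2 x10 x20 t10 t20; have p0 : 0 < p by lra.
have pq : p^-1 + q^-1 = 1 by field; lra.
have := hoelder2 (powR_ge0 x1 p^-1) (powR_ge0 x2 p^-1) (powR_ge0 t1 q^-1)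
  (powR_ge0 t2 q^-1) p0 (conjugate_gt0 p2) pq.
by rewrite !powRVK// gt_eqF// ?conjugate_gt0.
Qed.

(** In Hoelder's bound an energy [y] can be exchanged for any other energy [x]
    if the time is rescaled; [hoelder_sum] can then be used with a prescribed
    splitting of the energy. *)
Lemma reweight x y t : 2 <= p -> 0 < x -> 0 <= y -> 0 <= t ->
  y `^ p^-1 * t `^ q^-1 = x `^ p^-1 * (t * (y / x) `^ (p - 1)^-1) `^ q^-1.
Proof.
move=> p2 x0 y0 t0; have yx0 : 0 <= y / x by rewrite divr_ge0// ltW.
rewrite powRM ?powR_ge0// -powRrM.
have -> : (p - 1)^-1 * q^-1 = p^-1 by field; lra.
rewrite mulrCA -powRM//; last exact: ltW.
by rewrite mulrC [x * _]mulrC divfK// gt_eqF.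
Qed.

Lemma bernoulli_half x r : 0 <= r -> 0 <= x -> x <= 2^-1 ->
  1 - 2 * r * x <= (1 - x) `^ r.
Proof.
move=> r0 x0 x2.
have x1 : 0 < 1 - x by lra.
rewrite /powR gt_eqF//; apply: le_trans (expR_ge1Dx _).
have : ln (1 - x)^-1 <= 2 * x.
  rewrite -ler_expR lnK ?posrE ?invr_gt0//; apply: le_trans (expR_ge1Dx _).
  rewrite -[leLHS]div1r ler_pdivrMr//; nra.
rewrite lnV ?posrE// => h; nra.
Qed.

Definition gap_const := 2 + 2 `^ (p - 1 + 3) * (p - 1).

(** Here [t1 <= t2] are times, [H1 <= H2] the energies spent so far, and the
    deficits [t - f `^ q] are at most [l].  A small deficit at [t1] forces
    [1 - H1 <= 2 r s] with [r = p - 1] and [s = l / t1].  Split the energy as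
    [(1 - eta) + eta] with [eta] a large multiple of [s]: by [reweight] and
    [hoelder_sum], [f2 `^ q <= t1 * (1 + 2 * eta) + (t2 - t1) / 2].  The deficit
    at [t2] then gives [(t2 - t1) / 2 <= l + 2 * eta * t1], and [eta * t1] is a
    multiple of [l]. *)
Lemma energy_gap t1 t2 l f1 f2 H1 H2 :
  2 <= p -> 0 <= H1 -> H1 <= H2 -> H2 <= 1 -> 0 <= f1 -> 0 <= f2 -> 0 < l ->
  gap_const * l <= t1 -> t1 <= t2 ->
  f1 <= H1 `^ p^-1 * t1 `^ q^-1 ->
  f2 <= f1 + (H2 - H1) `^ p^-1 * (t2 - t1) `^ q^-1 ->
  t1 - f1 `^ q <= l -> t2 - f2 `^ q <= l -> t2 - t1 <= gap_const * l.
Proof.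
move=> p2 H10 H12 H21 f10 f20 l0 Kt1 t12 hf1 hf2 F1 F2.
set r := p - 1; have r1 : 1 <= r by rewrite /r; lra.
have q0 := conjugate_gt0 p2.
have qn0 : q != 0 by rewrite gt_eqF.
have r0 : 0 < r by apply: lt_le_trans r1.
set T := 2 `^ (r + 2) * r.
have K_E : gap_const = 2 + 2 * T.
  rewrite /gap_const /T -/r -[r + 3]/(r + (2 + 1)%:R) natrD addrA.
  by rewrite [2 `^ (_ + 1)]powRD ?pnatr_eq0 ?implybT// powRr1//; ring.
have T1 : 1 <= T.
  rewrite /T -[leLHS]mulr1 ler_pM//.
  by rewrite -[leLHS](powRr0 2) ler_powR ?ler1n//; lra.
rewrite K_E in Kt1 *.
have t10 : 0 < t1 by apply: lt_le_trans Kt1; nra.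
pose s := l / t1.
have sE : s * t1 = l by rewrite /s divfK// gt_eqF.
have s0 : 0 < s by rewrite divr_gt0.
have s2 : s <= 2^-1 by rewrite /s ler_pdivrMr//; nra.
have H1_ge : 1 - 2 * r * s <= H1.
  apply: le_trans (bernoulli_half _ _ s2) _; [lra|lra|].
  have -> : H1 = (H1 `^ r^-1) `^ r by rewrite powRVK// gt_eqF//; lra.
  apply: le_powR; [lra|lra|].
  have : f1 `^ q <= H1 `^ r^-1 * t1.
    apply: le_trans (le_powR _ _ hf1) _ => //; first exact: ltW.
    rewrite powRM ?powR_ge0// (powRVK (ltW t10))// -powRrM.
    have -> : p^-1 * q = r^-1 by rewrite /r; field; lra.
    by [].
  by move=> hf; rewrite -(ler_pM2r t10) mulrBl mul1r sE; lra.
(* The factor 2 ^ r makes (D / eta) ^ (1 / r) at most 1 / 2. *)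
pose eta := 2 `^ r * (2 * r * s).
have etaE : 2 * eta * t1 = T * l.
  rewrite /T /eta powRD ?pnatr_eq0 ?implybT// (powR_mulrn 2)// -sE; ring.
have pow2r : 0 < 2 `^ r by rewrite powR_gt0.
have eta0 : 0 < eta by rewrite /eta mulr_gt0// mulr_gt0// mulr_gt0.
have eta2 : eta <= 2^-1 by rewrite -(ler_pM2r t10); nra.
set d := t2 - t1; have d0 : 0 <= d by rewrite subr_ge0.
set D := H2 - H1; have D0 : 0 <= D by rewrite subr_ge0.
have hf1' : f1 <= 1 `^ p^-1 * t1 `^ q^-1.
  apply: le_trans hf1 _; rewrite ler_wpM2r ?powR_ge0//.
  apply: le_powR => //; [by rewrite invr_ge0; lra|lra].
have : f2 `^ q <= t1 * (1 + 2 * eta) + d * 2^-1.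
  have : f2 <= 1 `^ p^-1 *
      (t1 * (1 / (1 - eta)) `^ r^-1 + d * (D / eta) `^ r^-1) `^ q^-1.
    apply: le_trans hf2 _; apply: le_trans (lerD hf1' (lexx _)) _.
    rewrite (@reweight (1 - eta)) ?(ltW t10)//; last lra.
    rewrite [X in _ + X](@reweight eta)//.
    have -> : 1 `^ p^-1 = (1 - eta + eta) `^ p^-1 by congr (_ `^ _); ring.
    apply: hoelder_sum p2 _ (ltW eta0) _ _; first lra.
      exact: mulr_ge0 (ltW t10) (powR_ge0 _ _).
    exact: mulr_ge0 d0 (powR_ge0 _ _).
  rewrite powR1 mul1r => hf2'.
  apply: le_trans (le_powR _ _ hf2') _ => //; first exact: ltW.
  rewrite powRVK ?addr_ge0 ?mulr_ge0 ?powR_ge0 ?(ltW t10)//.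
  apply: lerD; [apply: (ler_wpM2l (ltW t10))|apply: (ler_wpM2l d0)].
    apply: le_trans (ler1_powR _ _) _.
    - by rewrite ler_pdivlMr; lra.
    - by rewrite invf_le1; lra.
    - by rewrite ler_pdivrMr; [nra|lra].
  have -> : 2^-1 = ((2 `^ r)^-1) `^ r^-1.
    by rewrite -powRN -powRrM mulNr divff ?gt_eqF ?powR_inv1//; lra.
  apply: le_powR.
  - by rewrite invr_ge0; lra.
  - by rewrite divr_ge0// ltW.
  - rewrite ler_pdivrMr// /eta mulKf ?gt_eqF// /D; lra.
have t2E : t2 = t1 + d by rewrite /d; ring.
by clear - F2 etaE t2E => h; lra.
Qed.

End gap.

(** * Hoelder's inequality in logarithmic time *)

Section hoelder_increment.
Context {R : realType}.
Implicit Types (a b x s e w p q : R) (f g u : R -> R) (D : set R).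
Local Notation leb := (@lebesgue_measure R).

Lemma hoelder_on D f g p q : measurable D -> measurable_fun D f -> measurable_fun D g ->
  (forall x, D x -> 0 <= f x) -> (forall x, D x -> 0 <= g x) ->
  0 < p -> 0 < q -> p^-1 + q^-1 = 1 ->
  (\int[leb]_(x in D) (f x * g x)%:E <=
   (\int[leb]_(x in D) (f x `^ p)%:E) `^ p^-1 *
   (\int[leb]_(x in D) (g x `^ q)%:E) `^ q^-1)%E.
Proof.
move=> mD mf mg f0 g0 p0 q0 pq.
have restr (r : R) (h : R -> R) : 0 < r -> (forall x, D x -> 0 <= h x) ->
    (\int[leb]_x `|((h \_ D) x)%:E| `^ r = \int[leb]_(x in D) (h x `^ r)%:E)%E.
  move=> r0 h0; rewrite [RHS]integral_mkcond; apply: eq_integral => x _.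
  rewrite !patchE; case: ifPn => xD; last first.
    have -> : point = 0%E :> \bar R by [].
    have -> : point = 0 :> R by [].
    by rewrite abse0 poweR0r// gt_eqF.
  by rewrite gee0_abs ?lee_fin ?h0//; exact/set_mem.
have mf' : measurable_fun setT (f \_ D) by apply/(measurable_restrictT _ mD).
have mg' : measurable_fun setT (g \_ D) by apply/(measurable_restrictT _ mD).
have := hoelder leb mf' mg' p0 q0 pq.
rewrite Lnorm1 unlock/= -!restr//; apply: le_trans.
rewrite integral_mkcond le_eqVlt; apply/orP; left; apply/eqP.
apply: eq_integral => x _; rewrite /= !patchE; case: ifPn => xD.
  by rewrite ger0_norm// mulr_ge0// ?f0 ?g0//; exact/set_mem.
by rewrite mulr0 normr0.
Qed.

(** Write [|u'|] as [|u'| * x `^ (1 / q)] times [x `^ (- 1 / q)]; since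
    [(p - 1) / p = 1 / q], the [p]-th power of the first factor is the energy
    density and the [q]-th power of the second is [1 / x]. *)
Lemma ac_increment_le p w a b u e : 2 <= p -> 0 < w -> 0 < a -> a <= b ->
  absolutely_continuous a b u -> measurable_fun `[a, b] (derive1 u) ->
  0 <= e ->
  (\int[leb]_(x in `]a, b]) (`|derive1 u x| `^ p * (w * x `^ (p - 1)))%:E <= e%:E)%E ->
  w `^ p^-1 * `|u b - u a| <= e `^ p^-1 * (ln b - ln a) `^ (p / (p - 1))^-1.
Proof.
move=> p2 w0 a0 ab acu mu e0 He.
have p0 : 0 < p by lra.
have q0 : 0 < p / (p - 1) by exact: conjugate_gt0.
have pq : p^-1 + (p / (p - 1))^-1 = 1 by field; lra.
set q := p / (p - 1) in q0 pq *.
have b0 := lt_le_trans a0 ab.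
have mS : measurable_fun (`]a, b] : set R) (derive1 u).
  by apply: measurable_funS mu => //; apply: subset_itvr; rewrite bnd_simp.
have gt0 x : `]a, b]%classic x -> 0 < x.
  by rewrite /= in_itv/= => /andP[ax _]; exact: lt_trans ax.
pose f x := `|derive1 u x| * (w * x `^ (p - 1)) `^ p^-1.
pose g x := x `^ (- q^-1).
have mf : measurable_fun (`]a, b] : set R) f.
  apply: measurable_funM; first exact: measurableT_comp.
  apply: measurable_funTS; apply: (measurableT_comp (measurable_powR _)).
  by apply: measurable_funM => //; exact: measurable_powR.
have mg : measurable_fun (`]a, b] : set R) g.
  by apply: measurable_funTS; exact: measurable_powR.
have f0 x : `]a, b]%classic x -> 0 <= f x by move=> _; rewrite mulr_ge0// powR_ge0.
have g0 x : `]a, b]%classic x -> 0 <= g x by move=> _; rewrite powR_ge0.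
have mab : measurable (`]a, b]%classic : set R) by exact: measurable_itv.
have := hoelder_on mab mf mg f0 g0 p0 q0 pq.
have -> : (\int[leb]_(x in `]a, b]) (f x * g x)%:E =
    \int[leb]_(x in `]a, b]) ((w `^ p^-1)%:E * `|derive1 u x|%:E))%E.
  apply: eq_integral => x; rewrite inE => /gt0 x0; rewrite -EFinM; congr EFin.
  rewrite /f /g (powRM _ (ltW w0) (powR_ge0 _ _)) -powRrM.
  have -> : (p - 1) * p^-1 = q^-1 by rewrite /q; field; lra.
  by rewrite powRN mulrA mulfK ?gt_eqF ?powR_gt0// mulrC.
rewrite ge0_integralZl//=; last 2 first.
- by apply/measurable_EFinP; exact: measurableT_comp.
- by rewrite lee_fin powR_ge0.
have -> : (\int[leb]_(x in `]a, b]) (f x `^ p)%:E =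
    \int[leb]_(x in `]a, b]) (`|derive1 u x| `^ p * (w * x `^ (p - 1)))%:E)%E.
  apply: eq_integral => x; rewrite inE => /gt0 x0; congr EFin.
  have wx0 : 0 <= w * x `^ (p - 1) by rewrite mulr_ge0 ?powR_ge0// ltW.
  rewrite /f (powRM _ (normr_ge0 _) (powR_ge0 _ _)).
  by rewrite (powRVK wx0 (lt0r_neq0 p0)).
have -> : (\int[leb]_(x in `]a, b]) (g x `^ q)%:E = (ln b - ln a)%:E)%E.
  transitivity (\int[leb]_(x in `]a, b]) (x `^ (-1))%:E)%E.
    apply: eq_integral => x _; congr EFin.
    by rewrite /g -powRrM mulNr mulVf// gt_eqF.
  rewrite integral_itv_obnd_cbnd; last first.
    by apply/measurable_EFinP/measurable_funTS; exact: measurable_powR.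
  rewrite -integral_inv//; apply: eq_integral => x; rewrite inE/= in_itv/= => /andP[ax _].
  by rewrite powR_inv1// (le_trans _ ax)// ltW.
move=> H; rewrite -lee_fin; apply: le_trans (le_trans _ H) _.
  rewrite EFinM; apply: lee_wpmul2l; first by rewrite lee_fin powR_ge0.
  exact: ac_le_int_derive.
rewrite EFinM -!poweR_EFin; apply: lee_wpmul2r; first exact: poweR_ge0.
apply: gt0_ler_poweR => //.
- by rewrite invr_ge0 ltW.
- rewrite in_itv/= leey andbT integral_ge0// => x _; rewrite lee_fin.
  by rewrite mulr_ge0 ?powR_ge0// mulr_ge0 ?powR_ge0// ltW.
- by rewrite in_itv/= leey andbT lee_fin.
Qed.

End hoelder_increment.

(** * Summation over the layers of the deficit *)

Section layers.
Context {R : realType}.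
Implicit Types (x : R) (l r : nat -> R).
Local Notation leb := (@lebesgue_measure R).

(** Half of the exponential absorbs the linear factor, the other half is
    compared with a geometric sequence. *)
Lemma succ_expRN_le n : n.+1%:R * expR (- n%:R) <= 2 * (2 / 3) ^+ n :> R.
Proof.
have -> : - n%:R = - (n%:R / 2) + - (n%:R / 2) :> R by lra.
rewrite expRD mulrA; apply: ler_pM; rewrite ?mulr_ge0 ?expR_ge0//.
  rewrite expRN ler_pdivrMr ?expR_gt0//.
  apply: le_trans (ler_wpM2l _ (expR_ge1Dx (n%:R / 2))) => //.
  by rewrite -natr1; lra.
have -> : - (n%:R / 2) = n%:R * (- 2^-1) :> R by lra.
rewrite expRM_natl; apply: lerXn2r; rewrite ?nnegrE ?expR_ge0//.
rewrite expRN -[leRHS]invrK lef_pV2 ?posrE ?expR_gt0 ?invr_gt0//.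
by apply: le_trans (expR_ge1Dx _); lra.
Qed.

Lemma sum_succ_expRN_le (c : R) : 0 <= c ->
  (\sum_(n <oo) (expR (- n%:R) * (c * n.+1%:R))%:E <= (6 * c)%:E)%E.
Proof.
move=> c0; apply: lime_le.
  by apply: is_cvg_nneseries => n _ _; rewrite lee_fin !mulr_ge0 ?expR_ge0.
apply: nearW => n; rewrite sumEFin lee_fin.
have geo m : \sum_(0 <= i < m) (2 / 3) ^+ i = 3 - 3 * (2 / 3) ^+ m :> R.
  elim: m => [|m IH]; first by rewrite big_nil expr0; lra.
  by rewrite big_nat_recr//= IH exprS; lra.
apply: (@le_trans _ _ (\sum_(0 <= i < n) (2 * c) * (2 / 3) ^+ i)).
  apply: ler_sum => i _; have := ler_wpM2l c0 (succ_expRN_le i); lra.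
rewrite -mulr_sumr geo; have : 0 <= c * (2 / 3) ^+ n by rewrite mulr_ge0 ?exprn_ge0//; lra.
lra.
Qed.

(** The density [dx / x] on the intervals [[l n, r n]] with weights
    [expR (- n)]: its integral is the weighted sum of the logarithmic lengths. *)
Definition layers l r x : \bar R :=
  (\sum_(n <oo) (expR (- n%:R) * (\1_(`[l n, r n]) x * x `^ (-1)))%:E)%E.

Lemma layers_term_ge0 l r n x : 0 <= expR (- n%:R) * (\1_(`[l n, r n]) x * x `^ (-1)).
Proof. by rewrite !mulr_ge0 ?expR_ge0 ?powR_ge0// indicE. Qed.

Lemma layers_ge0 l r x : (0 <= layers l r x)%E.
Proof. by apply: nneseries_ge0 => n _ _; rewrite lee_fin layers_term_ge0. Qed.

Lemma measurable_layers_term l r n :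
  measurable_fun setT (fun x => (expR (- n%:R) * (\1_(`[l n, r n]) x * x `^ (-1)))%:E : \bar R).
Proof.
apply/measurable_EFinP; apply: measurable_funM => //.
by apply: measurable_funM; [exact: measurable_indic|exact: measurable_powR].
Qed.

Lemma measurable_layers l r : measurable_fun setT (layers l r).
Proof.
rewrite /layers.
have := @ge0_emeasurable_sum _ (measurableTypeR R) R setT
  (fun n x => (expR (- n%:R) * (\1_(`[l n, r n]) x * x `^ (-1)))%:E) xpredT.
apply.
  by move=> n x _ _; rewrite lee_fin layers_term_ge0.
by move=> n _; exact: measurable_layers_term.
Qed.

Lemma layers_ge l r n x : l n <= x -> x <= r n -> 0 < x ->
  ((expR (- n%:R) / x)%:E <= layers l r x)%E.
Proof.
move=> lx xr x0; rewrite /layers.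
apply: (@le_trans _ _ (\sum_(0 <= i < n.+1)
    (expR (- i%:R) * (\1_(`[l i, r i]) x * x `^ (-1)))%:E)%E); last first.
  by apply: nneseries_lim_ge => i _ _; rewrite lee_fin layers_term_ge0.
rewrite big_nat_recr//= -[leLHS]add0e; apply: leeD.
  by apply: sume_ge0 => i _; rewrite lee_fin layers_term_ge0.
rewrite lee_fin indicE mem_set/=; last by rewrite in_itv/= lx xr.
by rewrite mul1r powR_inv1// ltW.
Qed.

Lemma integral_layers l r c : 0 <= c ->
  (forall n, 0 < l n) -> (forall n, l n <= r n) ->
  (forall n, ln (r n) - ln (l n) <= c * n.+1%:R) ->
  (\int[leb]_(x in `]0%R, +oo[) layers l r x <= (6 * c)%:E)%E.
Proof.
move=> c0 l0 lr lrc; rewrite /layers integral_nneseries//; last 2 first.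
- by move=> n; apply: measurable_funTS; exact: measurable_layers_term.
- by move=> n x _; rewrite lee_fin layers_term_ge0.
apply: le_trans (sum_succ_expRN_le c0); apply: lee_nneseries.
  by move=> n _ _; apply: integral_ge0 => x _; rewrite lee_fin layers_term_ge0.
move=> n _; under eq_integral do rewrite EFinM.
rewrite ge0_integralZl//=; last 2 first.
- apply/measurable_EFinP/measurable_funTS.
  by apply: measurable_funM; [exact: measurable_indic|exact: measurable_powR].
- by move=> x _; rewrite lee_fin mulr_ge0 ?powR_ge0// indicE.
rewrite [leRHS]EFinM; apply: lee_wpmul2l; first by rewrite lee_fin expR_ge0.
apply: (@le_trans _ _ (\int[leb]_(x in `[l n, r n]) (x^-1)%:E)%E); last first.
  by rewrite integral_inv// lee_fin.
rewrite integral_mkcond [leRHS]integral_mkcond le_eqVlt; apply/orP; left; apply/eqP.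
apply: eq_integral => x _; rewrite !patchE indicE mem_setE.
case: ifPn => /= xp; case: ifPn => //= xlr.
- rewrite mul1r powR_inv1//; move: xlr; rewrite mem_setE in_itv/= => /andP[lx _].
  by rewrite (le_trans _ lx)// ltW.
- by rewrite mul0r.
- exfalso; move: xp xlr; rewrite ?mem_setE !in_itv/= andbT => /negP xp /andP[lx _].
  by apply: xp; exact: lt_le_trans lx.
Qed.

End layers.

Section moser.
Context {R : realType}.
Local Notation leb := (@lebesgue_measure R).

(** The analytic core, with [t] the logarithmic time, [H x] the energy spent
    between [x] and the start and [f] the function to be exponentiated.  The points
    whose deficit [t x - f x `^ q] lies in [[n, n + 1)] have either
    [t x <= K * (n + 1)], or by [energy_gap] a time within [K * (n + 1)] of any one
    of them.  Both kinds fill an interval of logarithmic length [O(n + 1)], and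
    there the integrand is at most a constant times [expR (- n) / x]. *)
Lemma moser_layers (p th c x0 : R) (H f : R -> R) :
  let q := p / (p - 1) in
  let t x := (1 + th) * (ln x0 - ln x) + c in
  2 <= p -> 0 <= th -> 0 <= c -> 0 < x0 ->
  (forall x, 0 < x -> x <= x0 -> 0 <= H x /\ H x <= 1) ->
  (forall x, 0 <= f x) ->
  (forall x, 0 < x -> x <= x0 -> f x <= H x `^ p^-1 * t x `^ q^-1) ->
  (forall x y, 0 < x -> x <= y -> y <= x0 -> H y <= H x /\
    f x <= f y + (H x - H y) `^ p^-1 * (t x - t y) `^ q^-1) ->
  exists h : R -> \bar R, [/\ measurable_fun setT h, forall x, (0 <= h x)%E,
    forall x, 0 < x -> x <= x0 -> ((expR (f x `^ q) * x `^ th)%:E <= h x)%E &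
    (\int[leb]_(x in `]0%R, +oo[) h x <=
      (expR c * x0 `^ (1 + th) * (18 * gap_const p))%:E)%E].
Proof.
move=> q t p2 th0 c0 x00 H01 f0 fH fI.
set K := gap_const p.
have K2 : 2 <= K.
  by rewrite /K /gap_const lerDl mulr_ge0 ?powR_ge0//; lra.
have q0 : 0 < q by exact: conjugate_gt0.
have th1 : 0 < 1 + th by lra.
(* xi is the inverse of t. *)
pose xi T := expR (ln x0 - (T - c) / (1 + th)).
have xi_gt0 T : 0 < xi T by rewrite expR_gt0.
have lnxi T : ln (xi T) = ln x0 - (T - c) / (1 + th) by rewrite expRK.
have xi_le x T : 0 < x -> (xi T <= x) = (t x <= T).
  move=> xg0; rewrite -[in LHS](lnK (x := x)) ?posrE// /xi ler_expR /t.
  rewrite -(ler_pM2l th1) mulrBr mulrCA divff ?gt_eqF// mulr1.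
  by apply/idP/idP; lra.
have le_xi x T : 0 < x -> (x <= xi T) = (T <= t x).
  move=> xg0; rewrite -[in LHS](lnK (x := x)) ?posrE// /xi ler_expR /t.
  rewrite -(ler_pM2l th1) mulrBr mulrCA divff ?gt_eqF// mulr1.
  by apply/idP/idP; lra.
have xi_anti S T : S <= T -> xi T <= xi S.
  move=> ST; rewrite ler_expR lerD2l lerN2 ler_pM2r ?invr_gt0//; lra.
have t_anti x y : 0 < x -> x <= y -> t y <= t x.
  move=> xg0 xy; rewrite /t lerD2r ler_pM2l// lerD2l lerN2 ler_ln ?posrE//.
  exact: lt_le_trans xy.
have t_ge x : 0 < x -> x <= x0 -> c <= t x.
  by move=> xg0 xx0; apply: le_trans (t_anti _ _ xg0 xx0); rewrite /t subrr mulr0 add0r.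
pose F x := t x - f x `^ q.
have F0 x : 0 < x -> x <= x0 -> 0 <= F x.
  move=> xg0 xx0; have [H0 H1] := H01 x xg0 xx0.
  have t0 : 0 <= t x by exact: le_trans (t_ge x xg0 xx0).
  rewrite subr_ge0; apply: le_trans (le_powR (ltW q0) (f0 x) (fH x xg0 xx0)) _.
  rewrite (powRM _ (powR_ge0 _ _) (powR_ge0 _ _)) powRVK ?gt_eqF//.
  rewrite -[leRHS]mul1r; apply: ler_wpM2r => //.
  have one_pow : 1 = 1 `^ (p^-1 * q) :> R by rewrite powR1.
  rewrite -powRrM [leRHS]one_pow; apply: le_powR => //.
  by rewrite mulr_ge0 ?invr_ge0//; [lra|exact: ltW].
pose P n y := [/\ 0 < y, y <= x0, K * n.+1%:R <= t y & F y <= n.+1%:R].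
(* P n y: y is late and its deficit is at most n + 1.  The layer n is centred at
   the time s n of one such point, or of a default point when there is none. *)
pose s n := t (xget 0 (P n)).
pose lA (n : nat) := xi (K * n.+1%:R + c).
pose lB (n : nat) := xi (s n + K * n.+1%:R).
pose rB (n : nat) := xi (s n - K * n.+1%:R).
pose h x := ((expR c * x0 `^ (1 + th))%:E * (layers lA (fun=> xi c) x + layers lB rB x))%E.
have C0 : 0 <= expR c * x0 `^ (1 + th) by rewrite mulr_ge0 ?powR_ge0 ?expR_ge0.
have mh : measurable_fun setT h.
  by apply: measurable_funeM; apply: emeasurable_funD; exact: measurable_layers.
have gap x y n : 0 < x -> x <= y -> y <= x0 -> K * n.+1%:R <= t y ->
    F x <= n.+1%:R -> F y <= n.+1%:R -> t x - t y <= K * n.+1%:R.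
  move=> xg0 xy yx0 Ky Fx Fy; have yg0 := lt_le_trans xg0 xy.
  have [HH ff] := fI x y xg0 xy yx0.
  have [Hx0 Hx1] := H01 x xg0 (le_trans xy yx0).
  have [Hy0 Hy1] := H01 y yg0 yx0.
  by apply: (@energy_gap _ p (t y) (t x) n.+1%:R (f y) (f x) (H y) (H x)) => //;
    [exact: t_anti|exact: fH].
exists h; split => //.
- by move=> x; rewrite mule_ge0 ?lee_fin// adde_ge0// layers_ge0.
- move=> x xg0 xx0; rewrite /h.
  pose n := Num.truncn (F x).
  have /andP[nF Fn] := truncn_itv (F0 x xg0 xx0); rewrite -/n in nF Fn.
  apply: (@le_trans _ _ ((expR c * x0 `^ (1 + th))%:E * (expR (- n%:R) / x)%:E)%E).
    rewrite -EFinM lee_fin.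
    have -> : f x `^ q = t x - F x by rewrite /F; ring.
    have -> : x `^ th = expR (- (1 + th) * (- ln x)) / x.
      rewrite /powR gt_eqF// -{3}[x]lnK ?posrE// -expRN -expRD; congr expR; ring.
    have -> : x0 `^ (1 + th) = expR ((1 + th) * ln x0) by rewrite /powR gt_eqF.
    rewrite !mulrA ler_pM2r ?invr_gt0// -!expRD ler_expR /t; lra.
  apply: lee_wpmul2l; first by rewrite lee_fin.
  have Kn0 : 0 <= K * n.+1%:R by rewrite mulr_ge0//; lra.
  have [tK|tK] := leP (t x) (K * n.+1%:R).
    apply: le_trans (leeDl _ (layers_ge0 _ _ _)); apply: layers_ge => //.
      rewrite /lA xi_le//; lra.
    by rewrite le_xi// t_ge.
  apply: le_trans (leeDr _ (layers_ge0 _ _ _)).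
  have Px : P n x by split => //; exact: ltW.
  have [yg0 yx0 Ky Fy] : P n (xget 0 (P n)) by apply: xgetPex; exists x.
  apply: layers_ge => //; rewrite /lB /rB ?xi_le// ?le_xi// /s; set y := xget 0 (P n) in yg0 yx0 Ky Fy *.
    have [xy|yx] := leP x y; last by have := t_anti _ _ yg0 (ltW yx); lra.
    have := gap x y n xg0 xy yx0 Ky (ltW Fn) Fy; lra.
  have [xy|yx] := leP x y; first by have := t_anti _ _ xg0 xy; lra.
  have := gap y x n yg0 (ltW yx) xx0 (ltW tK) Fy (ltW Fn); lra.
- rewrite /h ge0_integralZl//; last 2 first.
  + by apply: measurable_funTS; apply: emeasurable_funD; exact: measurable_layers.
  + by move=> x _; rewrite adde_ge0// layers_ge0.
  rewrite [leRHS]EFinM; apply: lee_wpmul2l; first by rewrite lee_fin.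
  rewrite ge0_integralD//; last 4 first.
  + by move=> x _; exact: layers_ge0.
  + by apply: measurable_funTS; exact: measurable_layers.
  + by move=> x _; exact: layers_ge0.
  + by apply: measurable_funTS; exact: measurable_layers.
  (* One interval of length K * (n + 1) and one of twice that length. *)
  have -> : 18 * K = 6 * K + 6 * (2 * K) by ring.
  have len a : 0 <= a -> a / (1 + th) <= a.
    by move=> a0; rewrite ler_pdivrMr// ler_peMr//; lra.
  have KS n : 0 <= K * n.+1%:R by rewrite mulr_ge0//; lra.
  rewrite EFinD; apply: leeD; apply: integral_layers => //.
  + lra.
  + by move=> n; exact: xi_gt0.
  + by move=> n; apply: xi_anti; rewrite lerDr.
  + move=> n; rewrite /lA !lnxi subrr mul0r; have := len _ (KS n).
    by rewrite addrK; lra.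
  + lra.
  + by move=> n; exact: xi_gt0.
  + by move=> n; apply: xi_anti; have := KS n; lra.
  + move=> n; rewrite /lB /rB !lnxi; have := len _ (KS n).
    have -> : (s n + K * n.+1%:R - c) / (1 + th) =
        (s n - K * n.+1%:R - c) / (1 + th) + 2 * (K * n.+1%:R / (1 + th)).
      by field; rewrite gt_eqF.
    lra.
Qed.

End moser.

(** * The truncated exponential *)

Section truncated.
Context {R : realType}.
Implicit Types (p mu t y M : R) (n k : nat).

Lemma exp_partial_le y n : 0 <= y -> \sum_(0 <= j < n) y ^+ j / j`!%:R <= expR y.
Proof.
move=> y0; rewrite /expR; apply: (@nondecreasing_cvgn_le _ (series (exp_coeff y))).
  apply/nondecreasing_seqP => m.
  by rewrite /series/= big_nat_recr//= lerDl exp_coeff_ge0.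
exact: is_cvg_series_exp_coeff.
Qed.

(** The term of index [k + i] is at most [y ^+ k] times the term of index [i]. *)
Lemma exp_tail_le y k : 0 <= y ->
  expR y - \sum_(0 <= j < k) y ^+ j / j`!%:R <= y ^+ k * expR y.
Proof.
move=> y0; rewrite lerBlDr {1}/expR; apply: limr_le; first exact: is_cvg_series_exp_coeff.
near=> n.
have kn : (k <= n)%N by near: n; exact: nbhs_infty_ge.
rewrite /series/= (@big_cat_nat _ _ _ k)//= addrC lerD2r.
rewrite -{1}[k]add0n big_addn.
apply: le_trans (ler_wpM2l (exprn_ge0 k y0) (exp_partial_le (n - k) y0)).
rewrite mulr_sumr; apply: ler_sum => i _; rewrite /exp_coeff/= addnC exprD mulrA.
apply: ler_wpM2l; first by rewrite mulr_ge0// exprn_ge0.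
rewrite lef_pV2 ?posrE ?ltr0n ?fact_gt0// ler_nat.
by rewrite leq_fact// leq_addl.
Unshelve. all: by end_near. Qed.

(** The polynomial that is subtracted in the truncated exponential is of the
    order of [expR (y / 2)], hence negligible against [expR y]. *)
Lemma exp_partial_half y k : 0 <= y ->
  \sum_(0 <= j < k) y ^+ j / j`!%:R <= 2 ^+ k * expR (y / 2).
Proof.
move=> y0; have y20 : 0 <= y / 2 by lra.
apply: le_trans (ler_wpM2l (exprn_ge0 k (ler0n _ 2)) (exp_partial_le k y20)).
rewrite mulr_sumr !big_nat; apply: ler_sum => i /andP[_ ik]; rewrite mulrA.
rewrite ler_pM2r ?invr_gt0 ?ltr0n ?fact_gt0//.
rewrite -{1}[y](@divfK _ 2)// exprMn mulrC ler_wpM2r ?exprn_ge0//.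
by rewrite ler_weXn2l ?ler1n// ltnW.
Qed.

Lemma truncated_expE p mu t : 0 <= t ->
  truncated_exp p mu t = expR (mu * t `^ (p / (p - 1))) -
    \sum_(0 <= j < `|strict_floor p|%N) (mu * t `^ (p / (p - 1))) ^+ j / j`!%:R.
Proof.
move=> t0; rewrite /truncated_exp; congr (_ - _); apply: eq_bigr => j _.
by rewrite powRrM powR_mulrn ?powR_ge0// exprMn mulrAC.
Qed.

(** With [q * (p - 1) = p] this says that the first power kept in the truncated
    exponential has exponent at least [p]. *)
Lemma strict_floor_ge p : 2 <= p -> p - 1 <= (`|strict_floor p|%N)%:R.
Proof.
move=> p2; rewrite natr_absz ger0_norm.
  rewrite /strict_floor intrB lerD2r; exact: real_ceil_ge (num_real _).
rewrite /strict_floor subr_ge0 -(ler_int R); apply: le_trans (real_ceil_ge (num_real _)); lra.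
Qed.

Lemma truncated_exp_ge0 p mu t : 0 <= mu -> 0 <= t -> 0 <= truncated_exp p mu t.
Proof.
move=> mu0 t0; rewrite truncated_expE// subr_ge0.
by apply: exp_partial_le; rewrite mulr_ge0 ?powR_ge0.
Qed.

Lemma truncated_exp_le_exp p mu t : 0 <= mu -> 0 <= t ->
  truncated_exp p mu t <= expR (mu * t `^ (p / (p - 1))).
Proof.
move=> mu0 t0; rewrite truncated_expE// gerBl sumr_ge0// => j _.
by rewrite divr_ge0// exprn_ge0// mulr_ge0// powR_ge0.
Qed.

Definition truncated_exp_bound p mu M : R :=
  let q := p / (p - 1) in let k := `|strict_floor p|%N in
  mu ^+ k * M `^ (q * k%:R - p) * expR (mu * M `^ q).

Lemma truncated_exp_le_pow p mu M t : 2 <= p -> 0 <= mu -> 1 <= M ->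
  0 <= t -> t <= M -> truncated_exp p mu t <= truncated_exp_bound p mu M * t `^ p.
Proof.
move=> p2 mu0 M1 t0 tM; set q := p / (p - 1); set k := `|strict_floor p|%N.
have q0 : 0 < q by exact: conjugate_gt0.
have qk : 0 <= q * k%:R - p.
  rewrite subr_ge0 -[leLHS](@divfK _ (p - 1)); last by rewrite gt_eqF//; lra.
  by rewrite ler_wpM2l ?strict_floor_ge// ltW.
rewrite truncated_expE//; apply: le_trans (exp_tail_le _ _) _.
  by rewrite mulr_ge0 ?powR_ge0.
rewrite -/q -/k exprMn /truncated_exp_bound -/q -/k [leRHS]mulrAC.
apply: ler_pM; rewrite ?expR_ge0 ?mulr_ge0 ?exprn_ge0 ?powR_ge0//; last first.
  by rewrite ler_expR ler_wpM2l// le_powR// ltW.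
rewrite -mulrA ler_wpM2l ?exprn_ge0//.
rewrite -powR_mulrn ?powR_ge0// -powRrM.
have [->|tn0] := eqVneq t 0.
  rewrite powR0; first by rewrite mulr_ge0 ?powR_ge0.
  rewrite gt_eqF//; lra.
have -> : t `^ (q * k%:R) = t `^ (q * k%:R - p) * t `^ p.
  by rewrite -powRD ?tn0 ?implybT// subrK.
by rewrite ler_wpM2r ?powR_ge0// le_powR.
Qed.

Lemma measurable_truncated_exp p mu (D : set R) (f : R -> R) :
  measurable D -> measurable_fun D f ->
  measurable_fun D (fun x => truncated_exp p mu (f x)).
Proof.
move=> mD mf; apply: measurable_funB.
  apply: measurableT_comp => //; apply: measurable_funM => //.
  exact: (measurableT_comp (measurable_powR _)).
apply: measurable_sum => j; apply: measurable_funM => //.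
exact: (measurableT_comp (measurable_powR _)).
Qed.

End truncated.

(** * The bound up to the critical exponent *)

Section upper.
Context {R : realType}.
Implicit Types (p th w v mu : R) (u : R -> R).
Local Notation leb := (@lebesgue_measure R).
Local Notation pos := (`]0%R, +oo[%classic : set R).

Lemma powR_le1 (x r : R) : 0 <= r -> 0 <= x -> x <= 1 -> x `^ r <= 1.
Proof. by move=> r0 x0 /(le_powR r0 x0); rewrite powR1. Qed.

Lemma weight_ge0 (beta x : R) : 0 <= beta -> 0 <= omega beta * x `^ beta.
Proof. by move=> b0; rewrite mulr_ge0 ?powR_ge0//; exact/ltW/omega_gt0. Qed.

Lemma lambda_integral_ge0 (beta : R) (f : R -> R) : 0 <= beta -> (forall x, 0 <= f x) ->
  (0 <= lambda_integral beta f)%E.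
Proof.
move=> b0 f0; apply: integral_ge0 => x _.
by rewrite lee_fin mulr_ge0// weight_ge0.
Qed.

Lemma Lp_normK (beta p : R) u : 0 <= beta -> 0 < p ->
  (Lp_norm beta p u `^ p = lambda_integral beta (fun x => (`|u x| `^ p)%R))%E.
Proof.
move=> b0 p0; rewrite /Lp_norm -poweRrM mulVf ?gt_eqF// poweRe1//.
by apply: lambda_integral_ge0 => // x; exact: powR_ge0.
Qed.

Lemma measurable_weighted (beta : R) (f : R -> R) : measurable_fun pos f ->
  measurable_fun pos (fun x => f x * (omega beta * x `^ beta)).
Proof.
move=> mf; apply: measurable_funM => //; apply: measurable_funM => //.
by apply: measurable_funTS; exact: measurable_powR.
Qed.

Lemma measurable_norm_powR (D : set R) (f : R -> R) p : measurable D ->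
  measurable_fun D f -> measurable_fun D (fun x => `|f x| `^ p).
Proof.
move=> mD mf; apply: (measurableT_comp (measurable_powR _)).
exact: measurableT_comp.
Qed.

(** A minimum of [|u|] over [[y, 2 * y]]; the interval has length at least [1]
    and the weight is at least [omega th] there. *)
Lemma exists_small_value th p u (y N : R) : 0 <= th -> 0 < p -> 1 <= y ->
  locally_absolutely_continuous u -> measurable_fun pos u ->
  (lambda_integral th (fun x => (`|u x| `^ p)%R) <= N%:E)%E ->
  exists2 x, y <= x <= 2 * y & omega th * `|u x| `^ p <= N.
Proof.
move=> th0 p0 y1 acu mu IN; have v0 := omega_gt0 th0.
have y0 : 0 < y by lra.
have y2 : y <= 2 * y by lra.
have cu : {within `[y, 2 * y], continuous (fun x => `|u x|)}.
  have := ac_continuous (acu y (2 * y) y0 y2).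
  by move=> cu x; apply: continuous_comp; [exact: cu|exact: norm_continuous].
have [c cy cmin] := EVT_min y2 cu.
exists c; first by move: cy; rewrite in_itv.
rewrite -lee_fin; apply: le_trans IN.
apply: (@le_trans _ _ (\int[leb]_(x in `[y, (2 * y)%R]) (omega th * `|u c| `^ p)%:E)%E).
  rewrite integral_cst//= lebesgue_measure_itv/= lte_fin.
  rewrite ltr_pMl// ltr1n -EFinD -EFinM lee_fin ler_peMr//; last lra.
  by rewrite mulr_ge0 ?powR_ge0// ltW.
have mw : measurable_fun pos (fun x => `|u x| `^ p * (omega th * x `^ th)).
  by apply: measurable_weighted; exact: measurable_norm_powR.
have sub : `[y, 2 * y]%classic `<=` pos.
  by move=> x /=; rewrite !in_itv/= andbT => /andP[yx _]; exact: lt_le_trans yx.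
apply: (@le_trans _ _ (\int[leb]_(x in `[y, (2 * y)%R])
    (`|u x| `^ p * (omega th * x `^ th))%:E)%E).
  apply: le_integral_EFin => //; first exact: measurable_funS mw.
  move=> x; rewrite /= => xy; rewrite mulr_ge0 ?powR_ge0 ?(ltW v0)//= mulrC.
  apply: ler_pM; rewrite ?powR_ge0 ?(ltW v0)//.
    by apply: le_powR; rewrite ?(ltW p0)//; exact: cmin.
  rewrite ler_peMr ?(ltW v0)//.
  rewrite -[leLHS](powRr0 x) ler_powR//.
  by move: xy; rewrite in_itv/= => /andP[yx _]; lra.
apply: subset_integral_EFin => // x _.
by rewrite mulr_ge0 ?powR_ge0// weight_ge0.
Qed.

Lemma energy_of_norm1 p th u : 2 <= p -> 0 <= th ->
  W_norm (p - 1) th p u = 1%E ->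
  (lambda_integral (p - 1) (fun x => (`|derive1 u x| `^ p)%R) +
   lambda_integral th (fun x => (`|u x| `^ p)%R) = 1)%E.
Proof.
move=> p2 th0; have p0 : 0 < p by lra.
have p10 : 0 <= p - 1 by lra.
rewrite /W_norm !Lp_normK//; set S := (_ + _)%E => S1.
have S0 : (0 <= S)%E.
  by rewrite adde_ge0// lambda_integral_ge0// => x; exact: powR_ge0.
have := congr1 (fun z => (z `^ p)%E) S1.
by rewrite -poweRrM mulVf ?gt_eqF// poweRe1// poweR1r.
Qed.

Lemma set_energy (g : R -> R) (I : \bar R) : (forall x, 0 <= g x) ->
  measurable_fun pos g -> (\int[leb]_(x in pos) (g x)%:E)%E = I -> I \is a fin_num ->
  exists E : R -> R -> R, [/\
    forall x y, 0 < x -> (\int[leb]_(t in `]x, y]) (g t)%:E)%E = (E x y)%:E,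
    forall x y, 0 < x -> 0 <= E x y,
    forall x y, 0 < x -> E x y <= fine I &
    forall x y z, 0 < x -> x <= y -> y <= z -> E x z = E x y + E y z].
Proof.
move=> g0 mg IE If.
have sub_pos x y : 0 < x -> `]x, y]%classic `<=` pos.
  by move=> x0 z /=; rewrite !in_itv/= andbT => /andP[xz _]; exact: lt_trans xz.
have int0 x y : (0 <= \int[leb]_(t in `]x, y]) (g t)%:E)%E.
  by apply: integral_ge0 => t _; rewrite lee_fin.
have E_le x y : 0 < x -> (\int[leb]_(t in `]x, y]) (g t)%:E <= I)%E.
  by move=> x0; rewrite -IE; apply: subset_integral_EFin => //; exact: sub_pos.
have Ef x y : 0 < x -> (\int[leb]_(t in `]x, y]) (g t)%:E)%E \is a fin_num.
  move=> x0; rewrite ge0_fin_numE//.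
  by apply: le_lt_trans (E_le x y x0) _; rewrite ltey_eq If.
exists (fun x y => fine (\int[leb]_(t in `]x, y]) (g t)%:E)%E); split.
- by move=> x y x0; rewrite fineK// Ef.
- by move=> x y x0; exact: fine_ge0.
- by move=> x y x0; apply: fine_le => //; [exact: Ef|exact: E_le].
- move=> x y z x0 xy yz; have y0 := lt_le_trans x0 xy.
  rewrite -fineD; [|exact: Ef|exact: Ef]; congr fine.
  rewrite -ge0_integral_setU//.
  - by rewrite -itv_bndbnd_setU ?bnd_simp.
  - apply/measurable_EFinP; apply: measurable_funS mg => //.
    by move=> t [/(sub_pos _ _ x0)|/(sub_pos _ _ y0)].
  - by move=> t _; rewrite lee_fin.
  - apply/disj_setPLR => t/=; rewrite !in_itv/= => /andP[_ ty].
    by apply/negP; rewrite negb_and -leNgt ty.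
Qed.

(** All that the estimate near [0] uses of [u]: the energy [N] of the values, the
    additive gradient energy [E], a total energy at most [1], and Hoelder's
    bound. *)
Lemma energy_profile p th u : 2 <= p -> 0 <= th ->
  in_W (p - 1) th p u -> W_norm (p - 1) th p u = 1%E ->
  exists (N : R) (E : R -> R -> R), [/\ 0 <= N,
    (lambda_integral th (fun x => (`|u x| `^ p)%R) = N%:E)%E,
    forall x y, 0 < x -> 0 <= E x y /\ E x y + N <= 1,
    forall x y z, 0 < x -> x <= y -> y <= z -> E x z = E x y + E y z &
    forall x y, 0 < x -> x <= y -> omega (p - 1) `^ p^-1 * `|u y - u x| <=
      E x y `^ p^-1 * (ln y - ln x) `^ (p / (p - 1))^-1].
Proof.
move=> p2 th0 uW u1; have S1 := energy_of_norm1 p2 th0 u1.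
have p10 : 0 <= p - 1 by lra.
case: uW => acu _ [mdu _] _ {u1}.
have [I1 I1E] : exists I, I = lambda_integral (p - 1) (fun x => `|derive1 u x| `^ p).
  by eexists.
have [I2 I2E] : exists I, I = lambda_integral th (fun x => `|u x| `^ p).
  by eexists.
have I10 : (0 <= I1)%E.
  by rewrite I1E; apply: lambda_integral_ge0 => // x; exact: powR_ge0.
have I20 : (0 <= I2)%E.
  by rewrite I2E; apply: lambda_integral_ge0 => // x; exact: powR_ge0.
rewrite -I1E -I2E in S1 *.
have I1f : I1 \is a fin_num.
  by rewrite ge0_fin_numE//; apply: le_lt_trans (ltry 1); rewrite -S1 leeDl.
have I2f : I2 \is a fin_num.
  by rewrite ge0_fin_numE//; apply: le_lt_trans (ltry 1); rewrite -S1 leeDr.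
have NG : fine I1 + fine I2 = 1 by rewrite -fineD// S1.
pose g x := `|derive1 u x| `^ p * (omega (p - 1) * x `^ (p - 1)).
have g0 x : 0 <= g x by rewrite mulr_ge0 ?powR_ge0// weight_ge0.
have mg : measurable_fun pos g.
  by apply: measurable_weighted; exact: measurable_norm_powR.
have [E [EE E0 EI ED]] := set_energy g0 mg (esym I1E) I1f.
exists (fine I2), E; split.
- exact: fine_ge0.
- by rewrite fineK.
- by move=> x y x0; split; [exact: E0|rewrite -NG lerD2r EI].
- exact: ED.
- move=> x y x0 xy; apply: ac_increment_le => //.
  + exact: omega_gt0.
  + exact: acu.
  + apply: measurable_funS mdu => // t /=; rewrite !in_itv/= andbT => /andP[xt _].
    exact: lt_le_trans xt.
  + exact: E0.
  + by rewrite -EE.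
Qed.

(** A bound of [|u|] on [[1, +oo)]: the first term bounds the value at some point
    of [[x, 2 * x]], the second the increment up to that point.  The last summand
    makes the bound at least [1], as [truncated_exp_le_pow] requires. *)
Definition far_bound p w v : R := v^-1 `^ p^-1 + w^-1 `^ p^-1 + 1.

(** The constant [c] is the preliminary time for which Hoelder's bound with
    energy [N] is the largest possible value of the scaled [|u x0|]:
    [N `^ p^-1 * c `^ q^-1] equals [kap * (N / v) `^ p^-1], where [kap] is the
    scaling factor. *)
Lemma moser_core p th w v N u (E : R -> R -> R) :
  let q := p / (p - 1) in let c := (1 + th) * (w / v) `^ (p - 1)^-1 in
  2 <= p -> 0 <= th -> 0 < w -> 0 < v -> 0 <= N ->
  (forall y, 1 <= y -> exists2 x, y <= x <= 2 * y & v * `|u x| `^ p <= N) ->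
  (forall x y, 0 < x -> 0 <= E x y /\ E x y + N <= 1) ->
  (forall x y z, 0 < x -> x <= y -> y <= z -> E x z = E x y + E y z) ->
  (forall x y, 0 < x -> x <= y ->
    w `^ p^-1 * `|u y - u x| <= E x y `^ p^-1 * (ln y - ln x) `^ q^-1) ->
  (forall x, 1 <= x -> `|u x| <= far_bound p w v) /\
  exists (x0 : R) (h : R -> \bar R), [/\ 1 <= x0, measurable_fun setT h,
    forall x, (0 <= h x)%E,
    forall x, 0 < x -> x <= x0 ->
      ((expR ((1 + th) * w `^ (p - 1)^-1 * `|u x| `^ q) * x `^ th)%:E <= h x)%E &
    (\int[leb]_(x in pos) h x <=
      (expR c * 2 `^ (1 + th) * (18 * gap_const p))%:E)%E].
Proof.
move=> q c p2 th0 w0 v0 N0 small0 E01 ED incr.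
have p0 : 0 < p by lra.
have p10 : 0 < p - 1 by lra.
have th1 : 0 <= 1 + th by lra.
have pV0 : 0 <= p^-1 by rewrite invr_ge0 ltW.
have q0 : 0 < q by exact: conjugate_gt0.
have qV0 : 0 <= q^-1 by rewrite invr_ge0 ltW.
have qn0 : q != 0 by rewrite gt_eqF.
have pn0 : p != 0 by rewrite gt_eqF.
have c0 : 0 <= c by rewrite mulr_ge0 ?powR_ge0.
have N1 : N <= 1 by have [E0 E1] := E01 1 1 ltr01; lra.
have small y : 1 <= y -> exists2 x, y <= x <= 2 * y & `|u x| <= (N / v) `^ p^-1.
  move=> y1; have [x yx xN] := small0 y y1.
  exists x => //; rewrite -[leLHS](@powRKV _ _ p)//; apply: le_powR => //.
  by rewrite ler_pdivlMr// mulrC.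
have incr1 x y : 0 < x -> x <= y -> y <= 2 * x -> `|u y - u x| <= w^-1 `^ p^-1.
  move=> x0 xy y2x; have [E0 E1] := E01 x y x0.
  have wp0 : 0 < w `^ p^-1 by rewrite powR_gt0.
  rewrite -(ler_pM2l wp0) -powRM; [|exact: ltW|by rewrite invr_ge0 ltW].
  rewrite divff ?gt_eqF// powR1; apply: le_trans (incr x y x0 xy) _.
  have y0 := lt_le_trans x0 xy.
  have lnxy : 0 <= ln y - ln x by rewrite subr_ge0 ler_ln ?posrE.
  have lnxy1 : ln y - ln x <= 1.
    have : ln y <= ln (2 * x) by rewrite ler_ln ?posrE// mulr_gt0.
    rewrite lnM ?posrE// => h; have : ln 2 <= 1 :> R; last lra.
    rewrite -[leRHS]expRK ler_ln ?posrE ?expR_gt0//.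
    by apply: le_trans (expR_ge1Dx _); lra.
  have h1 : E x y `^ p^-1 <= 1.
    by apply: powR_le1 => //; lra.
  have h2 : (ln y - ln x) `^ q^-1 <= 1.
    by apply: powR_le1.
  by rewrite -[leRHS]mulr1; apply: ler_pM; rewrite ?powR_ge0.
have Nv : (N / v) `^ p^-1 <= v^-1 `^ p^-1.
  apply: le_powR => //; first by rewrite divr_ge0// ltW.
  by rewrite ler_piMl// invr_ge0 ltW.
have uM x : 1 <= x -> `|u x| <= far_bound p w v.
  move=> x1; have x0 : 0 < x by lra.
  have [z /andP[xz z2x] uz] := small x x1.
  have := incr1 x z x0 xz z2x; have := ler_normB (u z) (u z - u x).
  rewrite subKr /far_bound; lra.
have [x0 /andP[x01 x02] ux0] := small 1 (lexx _).
have x0_gt0 : 0 < x0 by lra.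
(* kap ^ q is the critical value of the exponent, as q / p = 1 / (p - 1). *)
pose kap := (1 + th) `^ q^-1 * w `^ p^-1.
have kap0 : 0 <= kap by rewrite mulr_ge0 ?powR_ge0.
pose f x := kap * `|u x|.
pose H x := N + E x x0.
have fq x : f x `^ q = (1 + th) * w `^ (p - 1)^-1 * `|u x| `^ q.
  rewrite /f /kap !powRM ?mulr_ge0 ?powR_ge0// powRVK//.
  rewrite -powRrM; congr (_ * _ `^ _ * _); rewrite /q; field; lra.
pose t x := (1 + th) * (ln x0 - ln x) + c.
have fI x y : 0 < x -> x <= y -> y <= x0 -> H y <= H x /\
    f x <= f y + (H x - H y) `^ p^-1 * (t x - t y) `^ q^-1.
  move=> xg0 xy yx0; have yg0 := lt_le_trans xg0 xy.
  have HE : H x - H y = E x y by rewrite /H (ED x y x0 xg0 xy yx0); ring.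
  have [E0 _] := E01 x y xg0.
  split; first by rewrite -subr_ge0 HE.
  have -> : t x - t y = (1 + th) * (ln y - ln x) by rewrite /t; ring.
  have lnxy : 0 <= ln y - ln x by rewrite subr_ge0 ler_ln ?posrE.
  rewrite HE powRM//.
  rewrite mulrCA -lerBlDl /f -mulrBr /kap -mulrA ler_wpM2l ?powR_ge0//.
  apply: le_trans (incr x y xg0 xy); rewrite ler_wpM2l ?powR_ge0//.
  by rewrite distrC; exact: lerB_dist.
have fH x : 0 < x -> x <= x0 -> f x <= H x `^ p^-1 * t x `^ q^-1.
  move=> xg0 xx0; have [_] := fI x x0 xg0 xx0 (lexx _).
  have [E0 _] := E01 x x0 xg0.
  have HE : H x - H x0 = E x x0.
    by have := ED x x0 x0 xg0 xx0 (lexx _); rewrite /H; lra.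
  have -> : t x - t x0 = (1 + th) * (ln x0 - ln x) by rewrite /t; ring.
  have lnx : 0 <= (1 + th) * (ln x0 - ln x).
    by rewrite mulr_ge0 ?subr_ge0 ?ler_ln ?posrE//; lra.
  rewrite HE => h; apply: le_trans h _.
  (* The initial value counts as energy N spent during the time c. *)
  have f0 : f x0 <= N `^ p^-1 * c `^ q^-1.
    apply: le_trans (ler_wpM2l kap0 ux0) _.
    have -> : c `^ q^-1 = (1 + th) `^ q^-1 * (w / v) `^ p^-1.
      rewrite /c powRM ?powR_ge0// -powRrM; congr (_ * _ `^ _).
      by rewrite /q; field; rewrite !gt_eqF.
    have swap : w `^ p^-1 * (N / v) `^ p^-1 = N `^ p^-1 * (w / v) `^ p^-1.
      by rewrite -!powRM ?divr_ge0 ?(ltW w0) ?(ltW v0)// mulrCA.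
    by rewrite /kap -mulrA swap mulrCA.
  apply: le_trans (lerD f0 (lexx _)) _.
  rewrite [t x]/t [_ * _ + c]addrC /H; exact: hoelder_sum.
split=> //.
have [||||h [mh h0 hge hint]] := moser_layers (p := p) (th := th) (c := c) (x0 := x0)
  (H := H) (f := f) p2 th0 c0 x0_gt0 _ _ _ _.
- by move=> x xg0 xx0; have [E0 E1] := E01 x x0 xg0; rewrite /H; split; lra.
- by move=> x; rewrite /f mulr_ge0.
- exact: fH.
- exact: fI.
exists x0, h; split=> //.
  by move=> x xg0 xx0; rewrite -fq; exact: hge.
apply: le_trans hint _; rewrite lee_fin ler_wpM2r//.
  by rewrite mulr_ge0// /gap_const addr_ge0// mulr_ge0 ?powR_ge0// ltW.
by rewrite ler_wpM2l ?expR_ge0// le_powR//; lra.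
Qed.

(** Up to [x0] the truncated exponential is bounded by the exponential with the
    critical exponent; beyond [x0] it is bounded by a multiple of
    [|u x| `^ p], whose integral is at most [1]. *)
Lemma moser_upper p th mu : 2 <= p -> 0 <= th -> 0 < mu -> mu <= mu_crit (p - 1) th ->
  exists D : R, forall u, in_W (p - 1) th p u -> W_norm (p - 1) th p u = 1%E ->
    (lambda_integral th (fun x => truncated_exp p mu `|u x|) <= D%:E)%E.
Proof.
move=> p2 th0 mu0; rewrite /mu_crit div1r => muc.
have p0 : 0 < p by lra.
have p10 : 0 <= p - 1 by lra.
have w0 := omega_gt0 p10; have v0 := omega_gt0 th0.
set q := p / (p - 1).
pose c := (1 + th) * (omega (p - 1) / omega th) `^ (p - 1)^-1.
pose M := far_bound p (omega (p - 1)) (omega th).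
exists (omega th * (expR c * 2 `^ (1 + th) * (18 * gap_const p)) + truncated_exp_bound p mu M).
move=> u uW u1.
have [N [E [N0 IN E01 ED incr]]] := energy_profile p2 th0 uW u1.
case: uW => acu [mu_ _] _ _ {u1}.
have small y : 1 <= y -> exists2 x, y <= x <= 2 * y & omega th * `|u x| `^ p <= N.
  by move=> y1; apply: exists_small_value => //; rewrite IN.
have N1 : N <= 1 by have [E0 E1] := E01 1 1 ltr01; lra.
have [uM [x0 [h [x01 mh h0 hge hint]]]] := moser_core p2 th0 w0 v0 N0 small E01 ED incr.
rewrite -/M -/q -/c in uM hge hint.
set B := truncated_exp_bound p mu M.
have M1 : 1 <= M by rewrite /M /far_bound lerDr addr_ge0 ?powR_ge0.
have B0 : 0 <= B.
  by rewrite /B /truncated_exp_bound !mulr_ge0 ?exprn_ge0 ?powR_ge0 ?expR_ge0// ltW.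
pose k x := `|u x| `^ p * (omega th * x `^ th).
have k0 x : 0 <= k x by rewrite mulr_ge0 ?powR_ge0// weight_ge0.
have mk : measurable_fun pos (EFin \o k).
  by apply/measurable_EFinP; apply: measurable_weighted; apply: measurable_norm_powR.
have mvh : measurable_fun pos (fun x => (omega th)%:E * h x)%E.
  by apply: measurable_funeM; exact: measurable_funTS.
have mBk : measurable_fun pos (fun x => B%:E * (k x)%:E)%E.
  by apply: measurable_funeM.
have vh0 x : (0 <= (omega th)%:E * h x)%E by apply: mule_ge0 (h0 x); rewrite lee_fin; exact: ltW.
have Bk0 x : (0 <= B%:E * (k x)%:E)%E by rewrite mule_ge0// lee_fin.
rewrite /lambda_integral.
apply: (@le_trans _ _ (\int[leb]_(x in pos) ((omega th)%:E * h x + B%:E * (k x)%:E))%E).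
  apply: ge0_le_integral => //.
  - move=> x _; rewrite lee_fin; apply: mulr_ge0; last exact: weight_ge0.
    exact: truncated_exp_ge0 (ltW mu0) (normr_ge0 _).
  - apply/measurable_EFinP; apply: measurable_weighted.
    apply: (@measurable_truncated_exp _ p mu _ (fun x => `|u x|)) => //.
    exact: measurableT_comp.
  - exact: emeasurable_funD.
  - move=> x; rewrite /= in_itv/= andbT => xg0.
    have [xx0|x0x] := leP x x0.
      apply: le_trans (leeDl _ (Bk0 x)).
      apply: (@le_trans _ _ ((omega th)%:E * (expR ((1 + th) * omega (p - 1) `^ (p - 1)^-1 * `|u x| `^ q) * x `^ th)%:E)%E).
        rewrite -EFinM lee_fin mulrCA ler_wpM2l ?(ltW v0)//.
        rewrite ler_wpM2r ?powR_ge0//.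
        apply: le_trans (truncated_exp_le_exp _ (ltW mu0) (normr_ge0 _)) _.
        by rewrite ler_expR ler_wpM2r ?powR_ge0.
      by apply: lee_wpmul2l; [rewrite lee_fin ltW|exact: hge].
    apply: le_trans (leeDr _ (vh0 x)).
    rewrite -EFinM lee_fin /k [leRHS]mulrA; apply: (ler_wpM2r (weight_ge0 _ th0)).
    apply: truncated_exp_le_pow => //; first exact: ltW.
    by apply: uM; lra.
rewrite ge0_integralD//.
rewrite EFinD; apply: leeD.
  rewrite ge0_integralZl; [| | |by move=> x _; exact: h0|by rewrite lee_fin ltW] => //.
    by rewrite [leRHS]EFinM; apply: lee_wpmul2l; first by rewrite lee_fin ltW.
  exact: measurable_funTS.
rewrite ge0_integralZl; [| | |by move=> x _; rewrite lee_fin|by rewrite lee_fin] => //.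
rewrite -[leRHS]mule1; apply: lee_wpmul2l; first by rewrite lee_fin.
by move: IN; rewrite /lambda_integral -/k => ->; rewrite lee_fin.
Qed.

End upper.

(** * Moser's functions *)

Section test_function.
Context {R : realType}.
Implicit Types (L x y a b p th : R).
Local Notation leb := (@lebesgue_measure R).
Local Notation pos := (`]0%R, +oo[%classic : set R).

Definition moser_fun L x := Num.min L (Num.max 0 (- ln x)).

Lemma moser_fun_ge0 L x : 0 <= L -> 0 <= moser_fun L x.
Proof. by move=> L0; rewrite /moser_fun le_min L0 le_max lexx. Qed.

Lemma ln_le_expRN L x : 0 < x -> (x <= expR (- L)) = (L <= - ln x).
Proof. by move=> x0; rewrite -{1}[x]lnK ?posrE// ler_expR lerNr. Qed.

Lemma moser_fun_flat L x : 0 <= L -> 0 < x -> x <= expR (- L) -> moser_fun L x = L.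
Proof.
move=> L0 x0; rewrite ln_le_expRN// => Lx.
by rewrite /moser_fun max_r ?min_l// (le_trans L0).
Qed.

Lemma moser_fun_log L x : 0 < x -> expR (- L) <= x -> x <= 1 -> moser_fun L x = - ln x.
Proof.
move=> x0 Lx x1; rewrite /moser_fun max_r; last by rewrite oppr_ge0 ln_le0.
by rewrite min_r// lerNl -ler_expR lnK ?posrE.
Qed.

Lemma moser_fun_out L x : 0 <= L -> 1 <= x -> moser_fun L x = 0.
Proof.
by move=> L0 x1; rewrite /moser_fun max_l ?min_r// oppr_le0 ln_ge0.
Qed.

Lemma moser_fun_le L x : 0 < x -> x <= 1 -> moser_fun L x <= - ln x.
Proof.
move=> x0 x1; rewrite /moser_fun ge_min max_r ?lexx ?orbT//.
by rewrite oppr_ge0 ln_le0.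
Qed.

Lemma ln_lipschitz a x y : 0 < a -> a <= x -> x <= y -> ln y - ln x <= a^-1 * (y - x).
Proof.
move=> a0 ax xy; have x0 := lt_le_trans a0 ax; have y0 := lt_le_trans x0 xy.
rewrite -ln_div ?posrE//; apply: (@le_trans _ _ (x^-1 * (y - x))).
  rewrite -ler_expR lnK ?posrE ?divr_gt0//; apply: le_trans (expR_ge1Dx _).
  by rewrite mulrBr mulVf ?gt_eqF// subrKC mulrC.
by rewrite ler_wpM2r ?subr_ge0// lef_pV2 ?posrE.
Qed.

(** Truncation does not increase distances, and [ln] is Lipschitz away from
    [0]. *)
Lemma moser_fun_lipschitz L a x y : 0 < a -> a <= x -> x <= y ->
  `|moser_fun L y - moser_fun L x| <= a^-1 * (y - x).
Proof.
move=> a0 ax xy; apply: le_trans (ln_lipschitz a0 ax xy).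
have : ln x <= ln y by rewrite ler_ln ?posrE//; [exact: lt_le_trans ax|apply: lt_le_trans xy; exact: lt_le_trans ax].
rewrite /moser_fun /Num.min /Num.max ler_norml; do ?case: ifPn; move=> *; apply/andP; split; lra.
Qed.

Lemma moser_fun_lac L : locally_absolutely_continuous (moser_fun L).
Proof.
move=> a b a0 ab e e0; exists (a * e); first exact: mulr_gt0.
move=> n l r lr _ lrd.
apply: (@le_lt_trans _ _ (\sum_(i < n) a^-1 * (r i - l i))).
  apply: ler_sum => i _; have [al li rb] := lr i.
  exact: moser_fun_lipschitz.
by rewrite -mulr_sumr mulrC ltr_pdivrMr// mulrC.
Qed.

Lemma measurable_moser_fun L (D : set R) : measurable D -> measurable_fun D (moser_fun L).
Proof.
move=> mD; apply: measurable_minr => //; apply: measurable_maxr => //.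
by apply: measurableT_comp => //; apply: measurable_funTS; exact: measurable_ln.
Qed.

(** The derivative of [moser_fun L] away from its two kinks [expR (- L)] and
    [1], where [derive1] has no useful value. *)
Definition moser_deriv L x := - x `^ (-1) * \1_(`[expR (- L), 1%R]) x.

Lemma derive1_moser_fun L x : 0 <= L -> 0 < x -> x != expR (- L) -> x != 1 ->
  derive1 (moser_fun L) x = moser_deriv L x.
Proof.
move=> L0 x0 xL x1.
suff H (d : R) : is_derive x 1 (moser_fun L) d -> d = moser_deriv L x ->
    derive1 (moser_fun L) x = moser_deriv L x.
  have [xl|lx] := leP x (expR (- L)).
    have {}xl : x < expR (- L) by rewrite lt_neqAle xL.
    apply: (H 0).
      have nE : \forall y \near x, cst L y = moser_fun L y.
        near=> y; rewrite moser_fun_flat//.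
          by near: y; exact: lt_nbhsr.
        by apply/ltW; near: y; exact: lt_nbhsl.
      exact: near_eq_is_derive nE (is_derive_cst _ _ _).
    by rewrite /moser_deriv indicE memNset ?mulr0//= in_itv/= => /andP[]; rewrite leNgt xl.
  have [x1'|x1'] := leP x 1.
    have {}x1' : x < 1 by rewrite lt_neqAle x1.
    apply: (H (- x^-1)).
      have nE : \forall y \near x, (- (@ln R)) y = moser_fun L y.
        near=> y; rewrite moser_fun_log//.
        - by near: y; exact: lt_nbhsr.
        - by apply/ltW; near: y; exact: lt_nbhsr.
        - by apply/ltW; near: y; exact: lt_nbhsl.
      exact: near_eq_is_derive nE (is_deriveN (is_derive1_ln x0)).
    rewrite /moser_deriv indicE mem_set ?mulr1 ?powR_inv1 ?(ltW x0)//=.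
    by rewrite in_itv/= !ltW.
  apply: (H 0).
    have nE : \forall y \near x, cst 0 y = moser_fun L y.
      near=> y; rewrite moser_fun_out//.
      by apply/ltW; near: y; exact: lt_nbhsr.
    exact: near_eq_is_derive nE (is_derive_cst _ _ _).
  by rewrite /moser_deriv indicE memNset ?mulr0//= in_itv/= => /andP[_]; rewrite leNgt x1'.
by move=> [_ <-] <-; rewrite derive1E.
Unshelve. all: by end_near. Qed.

Lemma measurable_moser_deriv L : measurable_fun setT (moser_deriv L).
Proof.
apply: measurable_funM; last exact: measurable_indic.
by apply: measurableT_comp => //; exact: measurable_powR.
Qed.

(** The values at two points are corrected by indicators; this covers the kinks
    of Moser's functions. *)
Lemma measurable_fun_except2 (D : set R) (f g : R -> R) a b : measurable D ->
  measurable_fun D g -> (forall x, D x -> x != a -> x != b -> f x = g x) ->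
  measurable_fun D f.
Proof.
move=> mD mg fg.
pose h x := g x + (f a - g a) * \1_[set a] x + (f b - g b) * \1_([set b] `\ a) x.
have mh : measurable_fun D h.
  apply: measurable_funD.
    by apply: measurable_funD => //; apply: measurable_funM => //; exact: measurable_indic.
  apply: measurable_funM => //; apply: measurable_indic; exact: measurableD.
apply: eq_measurable_fun mh => x; rewrite inE => Dx; rewrite /h !indicE.
have [->|xa] := eqVneq x a.
  rewrite mem_set//= memNset; last by case=> _; apply.
  by rewrite /= mulr0 mulr1; ring.
rewrite (@memNset _ [set a]) ?mulr0 ?addr0; last by move=> /= xa'; rewrite xa' eqxx in xa.
have [xb|xb] := eqVneq x b.
  rewrite mem_set; last by split => //= xa'; rewrite xa' eqxx in xa.
  by rewrite xb /= mulr1; ring.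
rewrite memNset ?mulr0 ?addr0 ?fg//.
by case=> /= xb'; rewrite xb' eqxx in xb.
Qed.

Lemma measurable_derive1_moser_fun L : 0 <= L -> measurable_fun pos (derive1 (moser_fun L)).
Proof.
move=> L0; apply: (@measurable_fun_except2 _ _ (moser_deriv L) (expR (- L)) 1) => //.
  by apply: measurable_funTS; exact: measurable_moser_deriv.
by move=> x /=; rewrite in_itv/= andbT => x0; exact: derive1_moser_fun.
Qed.

(** On [[expR (- L), 1]] the energy density is
    [x `^ (- p) * (w * x `^ (p - 1)) = w / x]: the weight [x `^ (p - 1)] is the one
    for which the logarithm has constant energy per unit of logarithmic time. *)
Lemma gradient_energy_moser_fun L p : 0 <= L -> 2 <= p ->
  lambda_integral (p - 1) (fun x => `|derive1 (moser_fun L) x| `^ p) = (omega (p - 1) * L)%:E.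
Proof.
move=> L0 p2; have p10 : 0 <= p - 1 by lra.
have w0 := omega_gt0 p10; have pn0 : p != 0 by rewrite gt_eqF//; lra.
have e1 : expR (- L) <= 1 by rewrite -expR0 ler_expR; lra.
rewrite /lambda_integral.
transitivity (\int[leb]_(x in pos) ((omega (p - 1))%:E *
    (x `^ (-1) * \1_(`[expR (- L), 1%R]) x)%:E))%E.
  apply: ae_eq_integral => //.
  - apply/measurable_EFinP; apply: measurable_weighted; apply: measurable_norm_powR => //.
    exact: measurable_derive1_moser_fun.
  - apply/measurable_EFinP; apply: measurable_funTS; apply: measurable_funM => //.
    by apply: measurable_funM; [exact: measurable_powR|exact: measurable_indic].
  exists [set expR (- L); 1]; split.
  - by apply: measurableU; exact: measurable_set1.
  - apply: countable_lebesgue_measure0; apply: finite_set_countable.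
    by rewrite finite_setU; split; exact: finite_set1.
  - move=> x /= /not_implyP[]; rewrite in_itv/= andbT => x0; apply: contra_notP.
    move=> /not_orP[/eqP xL /eqP x1]; rewrite derive1_moser_fun// -EFinM; congr EFin.
    rewrite /moser_deriv normrM normrN; set i := \1_ _ x.
    have -> : `|i| = i by rewrite ger0_norm// /i indicE.
    have i0 : 0 <= i by rewrite /i indicE.
    rewrite (ger0_norm (powR_ge0 x (-1))) (powRM _ (powR_ge0 _ _) i0).
    have -> : i `^ p = i.
      by rewrite /i indicE; case: (_ \in _); rewrite ?powR1 ?powR0.
    rewrite -powRrM mulrCA; congr (_ * _); rewrite mulrAC -powRD; last by rewrite (gt_eqF x0) implybT.
    by congr (_ `^ _ * _); ring.
rewrite ge0_integralZl; [| |
  |by move=> x _; rewrite lee_fin mulr_ge0 ?powR_ge0// indicE|by rewrite lee_fin ltW] => //; last first.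
  apply/measurable_EFinP; apply: measurable_funTS.
  by apply: measurable_funM; [exact: measurable_powR|exact: measurable_indic].
rewrite [RHS]EFinM; congr (_ * _)%E.
transitivity (\int[leb]_(x in `[expR (- L), 1%R]) (x^-1)%:E)%E.
  rewrite integral_mkcond [RHS]integral_mkcond; apply: eq_integral => x _.
  rewrite !patchE indicE mem_setE.
  case: ifPn => /= xp; case: ifPn => //= xlr.
  - rewrite mulr1 powR_inv1//; move: xlr; rewrite mem_setE in_itv/= => /andP[lx _].
    by apply: le_trans lx; exact: expR_ge0.
  - by rewrite mulr0.
  - exfalso; move: xp xlr; rewrite ?mem_setE !in_itv/= andbT => /negP xp /andP[lx _].
    by apply: xp; apply: lt_le_trans lx; exact: expR_gt0.
by rewrite integral_inv// ?expR_gt0// ln1 expRK; congr EFin; ring.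
Qed.

(** Uniformly in [L], since [(- ln x) `^ p <= (2 * p) `^ p * x `^ (- 1/2)]. *)
Lemma value_energy_moser_fun L p th : 0 <= L -> 2 <= p -> 0 <= th ->
  (lambda_integral th (fun x => (`|moser_fun L x| `^ p)%R) <=
   (omega th * (2 * p) `^ p * 2)%:E)%E.
Proof.
move=> L0 p2 th0; have v0 := omega_gt0 th0; have p0 : 0 < p by lra.
have C0 : 0 <= omega th * (2 * p) `^ p by rewrite mulr_ge0 ?powR_ge0// ltW.
have mdom : measurable_fun setT (fun x => x `^ (- 2^-1) * \1_(`]0%R, 1%R]) x).
  by apply: measurable_funM; [exact: measurable_powR|exact: measurable_indic].
have dom0 x : 0 <= x `^ (- 2^-1) * \1_(`]0%R, 1%R]) x.
  by rewrite mulr_ge0 ?powR_ge0// indicE.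
apply: (@le_trans _ _ (\int[leb]_(x in pos) ((omega th * (2 * p) `^ p)%:E *
    (x `^ (- 2^-1) * \1_(`]0%R, 1%R]) x)%:E))%E).
  rewrite /lambda_integral.
  apply: le_integral_EFin => //.
  - apply: measurable_weighted; apply: measurable_norm_powR => //.
    exact: measurable_moser_fun.
  - by apply: measurable_funM => //; exact: measurable_funTS.
  move=> x; rewrite /= in_itv/= andbT => x0.
  rewrite mulr_ge0 ?powR_ge0 ?weight_ge0//= ger0_norm ?moser_fun_ge0//.
  have [x1|x1] := leP x 1; last first.
    rewrite moser_fun_out//; last exact: ltW.
    by rewrite powR0 ?gt_eqF// mul0r mulr_ge0.
  rewrite indicE mem_set ?mulr1/=; last by rewrite in_itv/= x0 x1.
  rewrite mulrCA -[leRHS]mulrA; apply: ler_wpM2l; first exact: ltW.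
  have xth : x `^ th <= 1 by exact: powR_le1 th0 (ltW x0) x1.
  have ux : moser_fun L x `^ p <= (2 * p) `^ p * x `^ (- 2^-1).
    apply: (@le_trans _ _ ((- ln x) `^ p)).
      by apply: le_powR; rewrite ?moser_fun_ge0 ?moser_fun_le// ltW.
    have [->|ln0] := eqVneq (ln x) 0.
      by rewrite oppr0 powR0 ?gt_eqF// mulr_ge0 ?powR_ge0.
    have lnx : 0 < - ln x by rewrite lt_neqAle eq_sym oppr_eq0 ln0 oppr_ge0 ln_le0.
    apply: le_trans (le_powR_expR p0 lnx) _.
    rewrite ler_wpM2l ?powR_ge0// /powR gt_eqF// ler_expR; lra.
  rewrite -[leRHS]mulr1; apply: ler_pM; rewrite ?powR_ge0//.
under eq_integral do rewrite EFinM.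
rewrite ge0_integralZl; [| |
  |by move=> x _; rewrite lee_fin|by rewrite lee_fin] => //; last first.
  by apply/measurable_EFinP; exact: measurable_funTS.
rewrite [leRHS]EFinM; apply: lee_wpmul2l; first by rewrite lee_fin.
apply: le_trans integral_invsqrt.
rewrite integral_mkcond [leRHS]integral_mkcond le_eqVlt; apply/orP; left; apply/eqP.
apply: eq_integral => x _; rewrite !patchE indicE.
case: ifPn => /= xp; case: ifPn => //= xlr.
- by rewrite mulr1.
- by rewrite mulr0.
- exfalso; move: xp xlr; rewrite ?mem_setE !in_itv/= andbT => /negP xp /andP[lx _].
  exact: xp.
Qed.

End test_function.

(** * Blow-up beyond the critical exponent *)

Section blowup.
Context {R : realType}.
Implicit Types (L x p th mu : R).
Local Notation leb := (@lebesgue_measure R).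
Local Notation pos := (`]0%R, +oo[%classic : set R).

Definition value_const p th : R := omega th * (2 * p) `^ p * 2.

Lemma in_W_moser_fun L p th : 0 <= L -> 2 <= p -> 0 <= th -> in_W (p - 1) th p (moser_fun L).
Proof.
move=> L0 p2 th0; split.
- exact: moser_fun_lac.
- split; first exact: measurable_moser_fun.
  apply: poweR_lty; apply: le_lt_trans (value_energy_moser_fun L0 p2 th0) (ltry _).
- split; first exact: measurable_derive1_moser_fun.
  by apply: poweR_lty; rewrite gradient_energy_moser_fun// ltry.
- apply: cvg_near_cst; near=> x; apply: moser_fun_out => //.
Unshelve. all: by end_near. Qed.

Lemma W_norm_moser_fun L p th : 0 < L -> 2 <= p -> 0 <= th ->
  exists e : R, [/\ 0 <= e, e <= value_const p th &
    W_norm (p - 1) th p (moser_fun L) = ((omega (p - 1) * L + e) `^ p^-1)%:E].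
Proof.
move=> L0 p2 th0; have p0 : 0 < p by lra.
have p10 : 0 <= p - 1 by lra.
have I2le := value_energy_moser_fun (ltW L0) p2 th0.
have I20 : (0 <= lambda_integral th (fun x => (`|moser_fun L x| `^ p)%R))%E.
  by apply: lambda_integral_ge0 => // x; exact: powR_ge0.
rewrite /W_norm !Lp_normK// (gradient_energy_moser_fun (ltW L0) p2).
have I2f : lambda_integral th (fun x => (`|moser_fun L x| `^ p)%R) \is a fin_num.
  by rewrite ge0_fin_numE//; apply: le_lt_trans I2le (ltry _).
exists (fine (lambda_integral th (fun x => (`|moser_fun L x| `^ p)%R))); split.
- exact: fine_ge0.
- by rewrite -lee_fin fineK.
- by rewrite -[in LHS](fineK I2f) -EFinD poweR_EFin.
Qed.

(** Without [e] the right-hand side is [mu * w `^ (- 1 / (p - 1)) * L], which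
    exceeds [kap * L] exactly when [w < (mu / kap) `^ (p - 1)]; the excess absorbs
    [e] for large [L]. *)
Lemma supercritical_exponent p w mu kap L e C : 2 <= p -> 0 < w -> 0 < kap -> 0 < mu ->
  0 < L -> 0 <= e -> e <= C -> C <= ((mu / kap) `^ (p - 1) - w) * L ->
  kap * L <= mu * (L / (w * L + e) `^ p^-1) `^ (p / (p - 1)).
Proof.
move=> p2 w0 kap0 mu0 L0 e0 eC CL; set q := p / (p - 1).
have p10 : 0 < p - 1 by lra.
have p0 : 0 < p by lra.
have q0 : 0 < q by exact: conjugate_gt0.
have wLe0 : 0 < w * L + e by rewrite ltr_pwDl// mulr_gt0.
have pVq : p^-1 * q = (p - 1)^-1 by rewrite /q; field; rewrite !gt_eqF.
have mk0 : 0 < mu / kap by rewrite divr_gt0.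
rewrite powRM; [|exact: ltW|by rewrite invr_ge0 powR_ge0].
rewrite -powR_inv1 ?powR_ge0// -!powRrM mulrCA mulN1r mulrN pVq.
have den : (w * L + e) `^ (p - 1)^-1 <= (mu / kap) * L `^ (p - 1)^-1.
  have -> : mu / kap = ((mu / kap) `^ (p - 1)) `^ (p - 1)^-1.
    by rewrite powRKV ?gt_eqF// ltW.
  rewrite -powRM ?powR_ge0 ?(ltW L0)//; apply: le_powR; rewrite ?invr_ge0 ?(ltW p10) ?(ltW wLe0)//.
  lra.
have d0 : 0 < (w * L + e) `^ (p - 1)^-1 by rewrite powR_gt0.
rewrite powRN mulrA ler_pdivlMr//.
apply: le_trans (ler_wpM2l _ den) _; first by rewrite mulr_ge0// ltW.
have -> : L `^ q = L * L `^ (p - 1)^-1.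
  rewrite -{2}[L](powRr1 (ltW L0)) -powRD; last by rewrite (gt_eqF L0) implybT.
  by congr (_ `^ _); rewrite /q; field; rewrite gt_eqF.
rewrite le_eqVlt; apply/orP; left; apply/eqP; field; rewrite gt_eqF//.
Qed.

(** When [y] is large the subtracted polynomial is at most half of the
    exponential. *)
Lemma truncated_exp_lower p mu t y : 0 <= t -> 0 <= mu ->
  2 ^+ (`|strict_floor p|%N).+1 <= expR (y / 2) ->
  y <= mu * t `^ (p / (p - 1)) -> expR y / 2 <= truncated_exp p mu t.
Proof.
move=> t0 mu0 ylarge; rewrite truncated_expE//.
set z := mu * _ => yz; set k := `|strict_floor p|%N in ylarge *.
have z0 : 0 <= z by rewrite mulr_ge0 ?powR_ge0.
have zlarge : 2 ^+ k.+1 <= expR (z / 2).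
  by apply: le_trans ylarge _; rewrite ler_expR; lra.
have S := exp_partial_half k z0.
have zz : expR z = expR (z / 2) * expR (z / 2) by rewrite -expRD; congr expR; lra.
have yz' : expR y <= expR z by rewrite ler_expR.
have Z0 : 0 <= expR (z / 2) := expR_ge0 _.
have := ler_wpM2r Z0 zlarge; rewrite exprS -zz => h.
lra.
Qed.

(** Only [[expR (- L) / 2, expR (- L)]] is used: the function equals [L] there,
    and the interval has measure of the order of [expR (- (1 + th) * L)]. *)
Lemma blowup_lower L p th mu (kap n : R) : 2 <= p -> 0 <= th -> 0 < mu -> 0 < L -> 0 < n ->
  2 ^+ (`|strict_floor p|%N).+1 <= expR (kap * L / 2) ->
  kap * L <= mu * (L / n) `^ (p / (p - 1)) ->
  ((omega th / 2 * 2^-1 `^ (1 + th) * expR ((kap - (1 + th)) * L))%:E <=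
   lambda_integral th (fun x => truncated_exp p mu (`|moser_fun L x| / n)))%E.
Proof.
move=> p2 th0 mu0 L0 n0 large kL; have v0 := omega_gt0 th0.
set b := expR (- L); have b0 : 0 < b by exact: expR_gt0.
have b2 : b / 2 < b by lra.
have b20 : 0 < b / 2 by lra.
have nonneg x : 0 <= truncated_exp p mu (`|moser_fun L x| / n).
  by rewrite truncated_exp_ge0 ?divr_ge0// ltW.
have mA : measurable_fun pos (fun x => truncated_exp p mu (`|moser_fun L x| / n) * (omega th * x `^ th)).
  apply: measurable_weighted.
  apply: (@measurable_truncated_exp _ p mu _ (fun x => `|moser_fun L x| / n)) => //.
  apply: measurable_funM => //; apply: measurableT_comp => //.
  exact: measurable_moser_fun.
have sub : `[b / 2, b]%classic `<=` pos.
  by move=> x /=; rewrite !in_itv/= andbT => /andP[xb _]; exact: lt_le_trans xb.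
apply: (@le_trans _ _ (\int[leb]_(x in `[(b / 2)%R, b])
   (truncated_exp p mu (`|moser_fun L x| / n) * (omega th * x `^ th))%:E)%E); last first.
  apply: subset_integral_EFin => // x _; rewrite mulr_ge0// weight_ge0//.
apply: (@le_trans _ _ (\int[leb]_(x in `[(b / 2)%R, b])
   (expR (kap * L) / 2 * (omega th * (b / 2) `^ th))%:E)%E).
  rewrite integral_cst//= lebesgue_measure_itv/= lte_fin b2 -EFinD -EFinM lee_fin.
  rewrite le_eqVlt; apply/orP; left; apply/eqP.
  have -> : b - b / 2 = b / 2 by lra.
  have -> : (b / 2) `^ th = expR (- th * L) * 2^-1 `^ th.
    have -> : expR (- th * L) = b `^ th by rewrite /b -expRM; congr expR; ring.
    by rewrite powRM// ltW.
  have -> : 2^-1 `^ (1 + th) = 2^-1 * 2^-1 `^ th :> R.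
    by rewrite powRD ?invr_eq0 ?pnatr_eq0 ?implybT// powRr1.
  have -> : expR ((kap - (1 + th)) * L) = expR (kap * L) * expR (- th * L) * b.
    by rewrite /b -!expRD; congr expR; ring.
  by field.
apply: le_integral_EFin => //; first exact: measurable_funS mA.
move=> x; rewrite /= in_itv/= => /andP[bx xb].
have x0 : 0 < x by exact: lt_le_trans bx.
apply/andP; split.
  apply: mulr_ge0; first by rewrite divr_ge0 ?expR_ge0.
  by apply: mulr_ge0; [exact: ltW|exact: powR_ge0].
rewrite moser_fun_flat ?(ltW L0)// (ger0_norm (ltW L0)).
apply: ler_pM; rewrite ?divr_ge0 ?expR_ge0//.
- by rewrite mulr_ge0 ?powR_ge0// ltW.
- exact: (truncated_exp_lower (divr_ge0 (ltW L0) (ltW n0)) (ltW mu0) large kL).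
- by rewrite ler_wpM2l ?(ltW v0)// le_powR// ltW.
Qed.

(** Pick [kap] strictly between [1 + th] and the ratio of [mu] to
    [w `^ (p - 1)^-1]; the integrals then grow at least like
    [expR ((kap - (1 + th)) * L)] along [L = j + 1]. *)
Lemma moser_sharp p th mu : 2 <= p -> 0 <= th -> mu_crit (p - 1) th < mu ->
  (lambda_integral th (fun x => truncated_exp p mu
      (`|moser_fun j.+1%:R x| / fine (W_norm (p - 1) th p (moser_fun j.+1%:R))))
   @[j --> \oo] --> +oo)%E.
Proof.
move=> p2 th0; rewrite /mu_crit div1r => muc.
have p10 : 0 < p - 1 by lra.
have w0 := omega_gt0 (ltW p10); have v0 := omega_gt0 th0.
set w := omega (p - 1) in muc w0.
have wp0 : 0 < w `^ (p - 1)^-1 by rewrite powR_gt0.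
have th1 : 0 < 1 + th by lra.
have mu0 : 0 < mu by apply: lt_trans muc; rewrite mulr_gt0.
have [kap [k1 k2]] : exists kap : R, 1 + th < kap /\ w < (mu / kap) `^ (p - 1).
  pose m := mu / w `^ (p - 1)^-1.
  have m1 : 1 + th < m by rewrite ltr_pdivlMr.
  exists ((1 + th + m) / 2); have [h1 h2] := midf_lt m1; split => //.
  have k0 : 0 < (1 + th + m) / 2 by lra.
  rewrite -[ltLHS](@powRVK _ _ (p - 1) (ltW w0) (lt0r_neq0 p10)).
  apply: gt0_ltr_powR => //; rewrite ?nnegrE.
  - exact: powR_ge0.
  - exact: divr_ge0 (ltW mu0) (ltW k0).
  - by rewrite ltr_pdivlMr// mulrC -ltr_pdivlMr.
have k0 : 0 < kap by lra.
set d := (mu / kap) `^ (p - 1) - w; have d0 : 0 < d by rewrite subr_gt0.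
set C := value_const p th.
pose c := omega th / 2 * 2^-1 `^ (1 + th).
have c0 : 0 < c.
  by apply: mulr_gt0; [exact: divr_gt0|rewrite powR_gt0// invr_gt0].
have dk : 0 < kap - (1 + th) by lra.
apply/cvgeyPge => A; near=> j.
have jA : A / (c * (kap - (1 + th))) <= j.+1%:R.
  apply: (@le_trans _ _ j%:R); last by rewrite ler_nat.
  by near: j; exact: nbhs_infty_ger.
have jC : C / d <= j.+1%:R.
  apply: (@le_trans _ _ j%:R); last by rewrite ler_nat.
  by near: j; exact: nbhs_infty_ger.
have jk : 2 ^+ (`|strict_floor p|%N).+1 * 2 / kap <= j.+1%:R.
  apply: (@le_trans _ _ j%:R); last by rewrite ler_nat.
  by near: j; exact: nbhs_infty_ger.
have L0 : 0 < j.+1%:R :> R by [].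
have [e [e0 eC ->]] := W_norm_moser_fun L0 p2 th0.
rewrite [fine _]/=; set n := (_ + e) `^ _.
have n0 : 0 < n by rewrite powR_gt0// ltr_pwDl// mulr_gt0.
apply: (le_trans _ (blowup_lower (kap := kap) p2 th0 mu0 L0 n0 _ _)).
- rewrite lee_fin -/c -ler_pdivrMl//; apply: le_trans (_ : _ <= 1 + _) (expR_ge1Dx _).
  rewrite mulrC; apply: (@le_trans _ _ ((kap - (1 + th)) * j.+1%:R)); last by rewrite lerDr.
  rewrite -ler_pdivrMl//; apply: le_trans _ jA.
  by rewrite (invfM c) (mulrC c^-1) mulrCA.
- have := expR_ge1Dx (kap * j.+1%:R / 2); rewrite ler_pdivrMr// in jk.
  move: jk; clear -R; move=> jk h; lra.
- apply: supercritical_exponent eC _ => //.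
  by rewrite -/d mulrC -ler_pdivrMr.
Unshelve. all: by end_near. Qed.

End blowup.

(** * The sharp inequality *)

Unset Implicit Arguments.
Set Strict Implicit.
Set Printing Implicit Defensive.

Theorem theorem1p1 (R : realType) :
  (exists D : R -> R -> R -> R,
     forall p theta alpha mu : R,
       2 <= p -> 0 <= theta -> 0 <= alpha -> 0 < mu ->
       alpha - (p - 1) = 0 -> mu <= mu_crit alpha theta ->
     forall u : R -> R,
       in_W alpha theta p u -> W_norm alpha theta p u = 1%E ->
       (lambda_integral theta (fun x => truncated_exp p mu `|u x|)
          <= (D theta alpha mu)%:E)%E)
  /\
  (forall p theta alpha mu : R,
     2 <= p -> 0 <= theta -> 0 <= alpha ->
     alpha - (p - 1) = 0 -> mu_crit alpha theta < mu ->
   exists u : nat -> R -> R,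
     [/\ forall j, in_W alpha theta p (u j),
         forall j, exists2 x : R, 0 < x & u j x != 0 &
         lambda_integral theta
           (fun x => truncated_exp p mu (`|u j x| / fine (W_norm alpha theta p (u j))))
         @[j --> \oo] --> +oo%E]).
Proof.
split.
  (* The constant may depend on alpha but not on p; this is no restriction, since
     alpha determines p = alpha + 1. *)
- pose admissible (th a mu : R) := [/\ 2 <= a + 1, 0 <= th, 0 < mu & mu <= mu_crit a th].
  have bound th a mu : exists D : R, admissible th a mu -> forall u : R -> R,
      in_W a th (a + 1) u -> W_norm a th (a + 1) u = 1%E ->
      (lambda_integral th (fun x => truncated_exp (a + 1) mu `|u x|) <= D%:E)%E.
    have [[p2 th0 mu0 mule]|] := pselect (admissible th a mu); last by exists 0.
    have a1 : a + 1 - 1 = a by rewrite addrK.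
    rewrite -[a in mu_crit a]a1 in mule.
    have [D HD] := moser_upper p2 th0 mu0 mule.
    by exists D => _ u; have := HD u; rewrite a1.
  exists (fun th a mu => sval (cid (bound th a mu))).
  move=> p th a mu p2 th0 a0 mu0 ap mule u.
  have pa : p = a + 1 by lra.
  case: cid => D /= HD; rewrite pa in p2 *; apply: HD; by split.
- move=> p th a mu p2 th0 a0 ap muc.
  have pa : a = p - 1 by lra.
  rewrite pa in muc *.
  exists (fun j => moser_fun j.+1%:R); split.
  + by move=> j; exact: in_W_moser_fun.
  + move=> j; exists (expR (- j.+1%:R)); first exact: expR_gt0.
    by rewrite moser_fun_flat// ?expR_gt0// pnatr_eq0.
  + exact: moser_sharp.
Qed.
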